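(* Let $\pi$ and $\pi'$ be two different non-increasing unicyclic degree sequences with $\pi\lhd\pi'$, and let $f$ be a good escalating function. Let $U$ and $U'$ be extremal unicyclic graphs of $\Gamma(\pi)$ and $\Gamma(\pi')$, respectively (i.e., graphs maximizing $M_f$ in these classes). Then $M_f(U)<M_f(U')$.
   Context: Graphs are finite, simple, connected; $d(v)$ is the degree. A unicyclic graph is a connected graph with $n$ vertices and $n$ edges; a unicyclic degree sequence is the non-increasing degree sequence of some unicyclic graph; $\Gamma(\pi)$ is the set of connected graphs with degree sequence $\pi$. For non-increasing sequences $\pi=(x_1,\dots,x_n)$, $\pi'=(x'_1,\dots,x'_n)$, $\pi\lhd\pi'$ means $\pi\ne\pi'$, $\sum_i x_i=\sum_i x'_i$ and $\sum_{i=1}^j x_i\le\sum_{i=1}^j x'_i$ for all $j$. For a symmetric function $f(x,y)$ on pairs of positive reals, $M_f(G)=\sum_{uv\in E(G)}f(d(u),d(v))$. $f$ is escalating if $f(x_1,x_2)+f(y_1,y_2)\ge f(x_2,y_1)+f(x_1,y_2)$ for all $x_1\ge y_1>0$, $x_2\ge y_2>0$, strictly whenever $x_1>y_1$ and $x_2>y_2$. An escalating $f$ is good escalating if $\frac{\partial f}{\partial x}>0$, $\frac{\partial^2 f}{\partial x^2}\ge 0$, and $f(x_1+1,x_2)+f(x_1+1,y_1-1)\ge f(x_2,y_1)+f(x_1,y_1)$ for all $x_1\ge y_1$ and $x_2\ge 1$. *)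

(* Defs.v *)
From HB Require Import structures.
From mathcomp Require Import all_boot all_order all_algebra.
From mathcomp Require Import all_classical all_reals all_analysis.

Set Implicit Arguments.
Unset Strict Implicit.
Unset Printing Implicit Defensive.

Import Order.TTheory GRing.Theory Num.Theory.
Import numFieldNormedType.Exports.

Local Open Scope ring_scope.

Record sgraph := SGraph {
  vertex : finType;
  adj : rel vertex;
  adj_sym : symmetric adj;
  adj_irr : irreflexive adj }.

Definition deg (G : sgraph) (v : vertex G) : nat := #|[set w | adj v w]|.

(* The edge uv is represented by the one of the pairs (u, v), (v, u) that is
   increasing in the enumeration of the vertices. *)
Definition edges (G : sgraph) : {set vertex G * vertex G} :=
  [set p | adj p.1 p.2 & (enum_rank p.1 < enum_rank p.2)%N].

Definition connected_graph (G : sgraph) : Prop :=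
  (0 < #|vertex G|)%N /\ forall u v : vertex G, connect (@adj G) u v.

Definition unicyclic (G : sgraph) : Prop :=
  connected_graph G /\ #|edges G| = #|vertex G|.

Definition degree_seq (G : sgraph) : seq nat :=
  sort geq [seq deg v | v : vertex G].

Definition unicyclic_degree_seq (s : seq nat) : Prop :=
  exists G : sgraph, unicyclic G /\ degree_seq G = s.

Definition Gamma (s : seq nat) (G : sgraph) : Prop :=
  connected_graph G /\ degree_seq G = s.

Definition majorized (s t : seq nat) : Prop :=
  [/\ size s = size t, s <> t, sumn s = sumn t &
      forall j : nat, (j <= size s)%N -> (sumn (take j s) <= sumn (take j t))%N].

(* A function on pairs of positive reals is represented by f : R -> R -> R;
   all conditions below only involve its values at positive arguments. *)

Definition symmetric_pos (R : realType) (f : R -> R -> R) : Prop :=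
  forall x y : R, 0 < x -> 0 < y -> f x y = f y x.

Definition Mf (R : realType) (f : R -> R -> R) (G : sgraph) : R :=
  \sum_(p in edges G) f (deg p.1)%:R (deg p.2)%:R.

Definition escalating (R : realType) (f : R -> R -> R) : Prop :=
  forall x1 x2 y1 y2 : R, 0 < y1 -> y1 <= x1 -> 0 < y2 -> y2 <= x2 ->
    f x2 y1 + f x1 y2 <= f x1 x2 + f y1 y2 /\
    (y1 < x1 -> y2 < x2 -> f x2 y1 + f x1 y2 < f x1 x2 + f y1 y2).

(* In the last clause y1 > 1 says that (x1 + 1, y1 - 1) lies in the domain. *)
Definition good_escalating (R : realType) (f : R -> R -> R) : Prop :=
  [/\ escalating f,
      forall x y : R, 0 < x -> 0 < y ->
        derivable (fun t : R => f t y) x 1 /\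
        0 < (fun t : R => f t y)^`()%classic x,
      forall x y : R, 0 < x -> 0 < y ->
        derivable (fun t : R => f t y)^`()%classic x 1 /\
        0 <= (fun t : R => f t y)^`()^`()%classic x &
      forall x1 x2 y1 : R, 1 < y1 -> y1 <= x1 -> 1 <= x2 ->
        f x2 y1 + f x1 y1 <= f (x1 + 1) x2 + f (x1 + 1) (y1 - 1)].

Definition extremal (R : realType) (f : R -> R -> R) (s : seq nat)
    (G : sgraph) : Prop :=
  Gamma s G /\ forall H : sgraph, Gamma s H -> Mf f H <= Mf f G.

(* Main.v *)
Require Import Defs.
From HB Require Import structures.
From mathcomp Require Import all_classical all_reals all_analysis.
From mathcomp Require Import all_boot all_order all_algebra.
From mathcomp Require Import zify ring lra.

(** By majorization it suffices to move one unit of degree from a vertex [v] to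
    a vertex [u] with [d u >= d v >= 2], always staying below the target
    sequence. Fix an injective ranking [r] of the vertices refining the degrees
    and pick a connected graph with the given degrees maximizing first the
    weight, then the sum of [r x * r y] over the edges. The second criterion
    breaks ties, so no connected 2-switch can pair higher ranks better. Hence
    the neighbours of [u] dominate those of [v], and re-attaching a neighbour
    [w] of [v] to [u] increases the weight by convexity and escalation.
    Connectedness is easy to control: only the link between [u] and [v] can be
    lost in such an exchange.

    The re-attachment is impossible only if every neighbour of [v] is [u] or a
    neighbour of [u]; in a unicyclic graph [v] then has degree 2 and lies on a
    triangle or a 4-cycle with [u]. Choosing [v] of least rank among the
    non-leaves, maximality forces all leaves to hang on that cycle; counting
    leaves excludes the triangle and leaves a 4-cycle [u c1 v c2] with
    [d c1 = d c2 = 2], where [v c1, v c2] are replaced by [u v, c1 c2]. *)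

Set Implicit Arguments.
Unset Strict Implicit.
Unset Printing Implicit Defensive.
Import Order.TTheory GRing.Theory Num.Theory.
Import numFieldNormedType.Exports.
Local Open Scope ring_scope.

(** * Edge exchanges *)

Section GraphSurgery.
Variable T : finType.
Implicit Types (e : rel T) (a b u v w x y z : T).

Definition nbr e x : {set T} := [set y | e x y].

Definition degr e x : nat := #|nbr e x|.

Definition pair_rel a b : rel T :=
  fun x y => ((x == a) && (y == b)) || ((x == b) && (y == a)).

Definition add_edge e a b : rel T := fun x y => e x y || pair_rel a b x y.

Definition del_edge e a b : rel T := fun x y => e x y && ~~ pair_rel a b x y.

Definition switch e u v x y : rel T :=
  add_edge (add_edge (del_edge (del_edge e u x) v y) u y) v x.

Definition transfer e u v w : rel T := add_edge (del_edge e v w) u w.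

Definition spanning_connected e : Prop := forall x y, connect e x y.

(** Ordered pairs are summed, so on a symmetric relation each edge counts twice. Values in an
    arbitrary commutative monoid let the same lemmas serve real weights and degree counts. *)
Definition wsum (V : nmodType) (g : T -> T -> V) e : V :=
  \sum_x \sum_(y | e x y) g x y.

Lemma pair_relC a b x y : pair_rel a b x y = pair_rel a b y x.
Proof. by rewrite /pair_rel orbC; congr orb; rewrite andbC. Qed.

Lemma add_edge_sym e a b : symmetric e -> symmetric (add_edge e a b).
Proof. by move=> se x y; rewrite /add_edge se pair_relC. Qed.

Lemma del_edge_sym e a b : symmetric e -> symmetric (del_edge e a b).
Proof. by move=> se x y; rewrite /del_edge se pair_relC. Qed.

Lemma add_edge_irr e a b : a != b -> irreflexive e -> irreflexive (add_edge e a b).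
Proof.
move=> ab ie x; rewrite /add_edge ie /pair_rel /= andbC orbb.
by apply/negP => /andP[/eqP-> /eqP ba]; rewrite ba eqxx in ab.
Qed.

Lemma del_edge_irr e a b : irreflexive e -> irreflexive (del_edge e a b).
Proof. by move=> ie x; rewrite /del_edge ie. Qed.

Lemma wsum_pair (V : nmodType) (g : T -> T -> V) e :
  wsum g e = \sum_(p | e p.1 p.2) g p.1 p.2.
Proof. by rewrite /wsum pair_big_dep. Qed.

Lemma wsum_add_edge (V : nmodType) (g : T -> T -> V) e a b :
  a != b -> symmetric e -> ~~ e a b ->
  wsum g (add_edge e a b) = wsum g e + (g a b + g b a).
Proof.
move=> ab se neab; rewrite !wsum_pair.
rewrite (bigD1 (a, b)) /=; last by rewrite /add_edge /pair_rel !eqxx orbT.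
rewrite (bigD1 (b, a)) /=; last first.
  by rewrite /add_edge /pair_rel !eqxx /= !orbT xpair_eqE (negPf ab) andbF.
rewrite addrA addrC; congr (_ + _); apply: eq_bigl => -[x y] /=.
rewrite /add_edge /pair_rel !xpair_eqE.
have ba : (b == a) = false by rewrite eq_sym (negPf ab).
have neba : e b a = false by rewrite se (negPf neab).
have [->|xa] := eqVneq x a; have [->|yb] := eqVneq y b;
  rewrite ?(negPf ab) ?(negPf neab) ?ba ?eqxx /= ?andbF ?andbT ?orbF //.
have [->|xb] := eqVneq x b; have [->|ya] := eqVneq y a => //=;
by rewrite ?neba ?orbF ?andbT ?andbF.
Qed.

Lemma add_del_edge e a b : symmetric e -> e a b ->
  add_edge (del_edge e a b) a b =2 e.
Proof.
move=> se eab x y; rewrite /add_edge /del_edge.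
case E: (pair_rel a b x y); rewrite /= ?orbT ?andbT ?orbF //.
by case/orP: E => /andP[/eqP-> /eqP->]; rewrite ?eab // se eab.
Qed.

Lemma eq_wsum (V : nmodType) (g : T -> T -> V) e e' :
  e =2 e' -> wsum g e = wsum g e'.
Proof. by move=> ee; rewrite !wsum_pair; apply: eq_bigl => -[x y]; rewrite /= ee. Qed.

Lemma wsum_del_edge (V : nmodType) (g : T -> T -> V) e a b :
  a != b -> symmetric e -> e a b ->
  wsum g e = wsum g (del_edge e a b) + (g a b + g b a).
Proof.
move=> ab se eab; rewrite -wsum_add_edge //; last 2 first.
- exact: del_edge_sym.
- by rewrite /del_edge /pair_rel !eqxx andbF.
by apply: eq_wsum => x y; rewrite add_del_edge.
Qed.

(** With the degree written as a [wsum] of an indicator, the lemmas on adding, deleting and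
    switching edges yield the degree changes as instances. *)
Lemma degr_wsum e z : degr e z = wsum (fun x _ => (x == z : nat)) e.
Proof.
rewrite /wsum (bigD1 z) //= [X in _ = X + _](_ : _ = degr e z); last first.
  by rewrite eqxx sum_nat_const muln1 /degr /nbr cardsE.
rewrite big1 ?addr0 // => x xz; rewrite big1 // => y _.
by rewrite (negPf xz).
Qed.

Lemma degr_add_edge e a b z : a != b -> symmetric e -> ~~ e a b ->
  degr (add_edge e a b) z = (degr e z + ((a == z) + (b == z)))%N.
Proof. by move=> *; rewrite !degr_wsum wsum_add_edge. Qed.

Lemma degr_del_edge e a b z : a != b -> symmetric e -> e a b ->
  degr e z = (degr (del_edge e a b) z + ((a == z) + (b == z)))%N.
Proof. by move=> *; rewrite !degr_wsum; apply: wsum_del_edge. Qed.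

Lemma sum_degr e : (\sum_x degr e x)%N = wsum (fun _ _ => 1%N) e.
Proof.
by apply: eq_bigr => x _; rewrite sum_nat_const muln1 /degr /nbr cardsE.
Qed.

Section SwitchSection.
Variables (e : rel T) (u v x y : T).
Hypotheses (se : symmetric e) (ie : irreflexive e).
Hypotheses (uv : u != v) (xv : x != v) (yu : y != u).
Hypotheses (eux : e u x) (evy : e v y) (neuy : ~~ e u y) (nevx : ~~ e v x).

Let xu : x != u. Proof. by apply/eqP => E; move: eux; rewrite E ie. Qed.
Let yv : y != v. Proof. by apply/eqP => E; move: evy; rewrite E ie. Qed.
Let xy : x != y. Proof. by apply/eqP => E; move: neuy; rewrite -E eux. Qed.

Lemma switch_sym : symmetric (switch e u v x y).
Proof. by do 2![apply: add_edge_sym]; do 2![apply: del_edge_sym]. Qed.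

Lemma switch_irr : irreflexive (switch e u v x y).
Proof.
apply: add_edge_irr; first by rewrite eq_sym.
apply: add_edge_irr; first by rewrite eq_sym.
by do 2![apply: del_edge_irr].
Qed.

(** A balance of lost and gained edges, free of subtraction so that it also applies in [nat]. *)
Lemma wsum_switch (V : nmodType) (g : T -> T -> V) :
  wsum g (switch e u v x y) + ((g u x + g x u) + (g v y + g y v)) =
  wsum g e + ((g u y + g y u) + (g v x + g x v)).
Proof.
have xuN := negPf xu; have yvN := negPf yv; have xyN := negPf xy.
have uvN := negPf uv; have xvN := negPf xv; have yuN := negPf yu.
have s1 : symmetric (del_edge e u x) by apply: del_edge_sym.
have s2 : symmetric (del_edge (del_edge e u x) v y) by apply: del_edge_sym.
have s3 : symmetric (add_edge (del_edge (del_edge e u x) v y) u y).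
  exact: add_edge_sym.
rewrite /switch wsum_add_edge //; last 2 first.
- by rewrite eq_sym.
- rewrite /add_edge /del_edge (negPf nevx) /pair_rel /= (eq_sym v u) uvN.
  by rewrite xuN andbF.
rewrite wsum_add_edge //; last 2 first.
- by rewrite eq_sym.
- by rewrite /del_edge (negPf neuy).
rewrite (@wsum_del_edge _ g e u x) //; last by rewrite eq_sym.
rewrite (@wsum_del_edge _ g (del_edge e u x) v y) //; last 2 first.
- by rewrite eq_sym.
- by rewrite /del_edge evy /pair_rel (eq_sym v u) uvN (eq_sym v x) xvN.
move: (g u y + g y u) (g v x + g x v) (g u x + g x u) (g v y + g y v).
move=> A B C D; rewrite -!addrA; congr (_ + _).
by rewrite addrA addrC (addrC C) -addrA.
Qed.

Lemma degr_switch z : degr (switch e u v x y) z = degr e z.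
Proof.
have := wsum_switch (fun x _ => (x == z : nat)); rewrite -!degr_wsum /=.
by rewrite /GRing.add /=; lia.
Qed.

Lemma switch_keep a b : e a b ->
  ~~ pair_rel u x a b -> ~~ pair_rel v y a b -> switch e u v x y a b.
Proof. by rewrite /switch /add_edge /del_edge => -> -> ->. Qed.

End SwitchSection.

(* The part of the graph away from the two hubs is untouched and every piece of
   it keeps an attachment to one of them, so only the hubs need to be linked. *)
Lemma hub_connected e e' u v :
  spanning_connected e -> symmetric e' -> connect e' u v ->
  (forall x y, x != u -> x != v -> y != u -> y != v -> e x y -> e' x y) ->
  (forall z, z != u -> z != v -> e u z || e v z -> e' u z || e' v z) ->
  spanning_connected e'.
Proof.
move=> ce se' cuv off att.
have step x y : e x y -> connect e' u x -> connect e' u y.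
  move=> exy cux.
  have [->|yu] := eqVneq y u; first exact: connect0.
  have [->|yv] := eqVneq y v; first by [].
  have [xuv|/norP[xu xv]] := boolP ((x == u) || (x == v)).
    have : e u y || e v y by case/orP: xuv => /eqP <-; rewrite exy ?orbT.
    case/(att _ yu yv)/orP => [|evy]; first exact: connect1.
    exact: connect_trans cuv (connect1 evy).
  exact: connect_trans cux (connect1 (off _ _ xu xv yu yv exy)).
have all_u z : connect e' u z.
  have /connectP[p pp ->] := ce u z.
  have: connect e' u u by exact: connect0.
  move: {1 3 5}u pp => t; elim: p t => //= a p IH t /andP[eta pp] ut.
  by apply: IH pp _; apply: step eta ut.
move=> x y; apply: connect_trans (all_u y).
by rewrite (sym_connect_sym se').
Qed.

Lemma switch_connected e u v x y :
  symmetric e -> spanning_connected e -> x != u -> x != v -> y != u -> y != v ->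
  connect (switch e u v x y) u v -> spanning_connected (switch e u v x y).
Proof.
move=> se ce xu xv yu yv; have ss : symmetric (switch e u v x y).
  by do 2![apply: add_edge_sym]; do 2![apply: del_edge_sym].
move=> cuv; apply: hub_connected ce ss cuv _ _ => [a b au av bu bv eab|z zu zv].
  apply: switch_keep => //; rewrite /pair_rel ?(negPf au) ?(negPf av)
    ?(negPf bu) ?(negPf bv) ?andbF //.
have [->|zx] := eqVneq z x.
  by move=> _; rewrite /switch /add_edge /pair_rel !eqxx ?orbT.
have [->|zy] := eqVneq z y.
  by move=> _; rewrite /switch /add_edge /pair_rel !eqxx ?orbT.
case/orP => [euz|evz]; apply/orP; [left|right]; apply: switch_keep => //;
by rewrite /pair_rel ?(negPf zx) ?(negPf zy) ?(negPf zu) ?(negPf zv) ?andbF.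
Qed.

Lemma transfer_connected e u v w :
  symmetric e -> spanning_connected e -> w != u -> w != v ->
  connect (transfer e u v w) u v -> spanning_connected (transfer e u v w).
Proof.
move=> se ce wu wv; have ss : symmetric (transfer e u v w).
  by apply: add_edge_sym; apply: del_edge_sym.
move=> cuv; apply: hub_connected ce ss cuv _ _ => [a b au av bu bv eab|z zu zv].
  by rewrite /transfer /add_edge /del_edge eab /pair_rel (negPf av) (negPf bv) andbF.
have [->|zw] := eqVneq z w.
  by move=> _; rewrite /transfer /add_edge /pair_rel !eqxx ?orbT.
rewrite /transfer /add_edge /del_edge /pair_rel (negPf zw) (negPf zv) !andbF /=.
by rewrite !andbT => /orP[->|->]; rewrite ?orbT.
Qed.

End GraphSurgery.

(** * Counting edges, leaves and non-leaves *)

Section Counting.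
Variable T : finType.
Implicit Types (e : rel T) (a b c u v w x y z : T) (S : {set T}).

Lemma crossing_edge e S a b : spanning_connected e -> a \in S -> b \notin S ->
  exists x y, [/\ x \in S, y \notin S & e x y].
Proof.
move=> ce aS bS; have /connectP[p pp lp] := ce a b.
elim: p a aS pp lp => [|c p IH] a aS /=; first by move=> _ ba; rewrite ba aS in bS.
case/andP => eac pp lp; have [cS|cS] := boolP (c \in S); first exact: IH cS pp lp.
by exists a, c.
Qed.

Lemma degr_sum e x : degr e x = (\sum_y e x y)%N.
Proof.
rewrite /degr /nbr -sum1_card [RHS]big_mkcond /= [LHS]big_mkcond.
by apply: eq_bigr => y _; rewrite inE; case: (e x y).
Qed.

(* Adding the vertices outside [S] one at a time, each along a crossing edge. *)
Lemma induced_edges_le e S : symmetric e -> spanning_connected e -> S != set0 ->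
  (\sum_(x in S) \sum_(y in S) e x y + 2 * (#|T| - #|S|) <= \sum_x degr e x)%N.
Proof.
move=> se ce; move: {2}(#|T| - #|S|)%N (leqnn (#|T| - #|S|)) => n.
elim: n S => [|n IH] S.
  rewrite leqn0 subn_eq0 => TS _.
  have -> : S = [set: T] by apply/eqP; rewrite eqEcard subsetT cardsT.
  rewrite cardsT subnn muln0 addn0.
  rewrite big_mkcond; apply: leq_sum => x _; rewrite in_setT degr_sum big_mkcond.
  by apply: leq_sum => y _; rewrite in_setT.
move=> leS S0; have [TS|TS] := leqP #|T| #|S|; first by apply: IH => //; lia.
have [a aS] : exists a, a \in S by apply/set0Pn.
have [b bS] : exists b, b \notin S.
  apply/existsP; rewrite -negb_forall; apply/negP => /forallP allS.
  move: TS; rewrite ltnNge => /negP; apply; rewrite -cardsT subset_leq_card //.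
  by apply/subsetP => x _; apply: allS.
have [x [y [xS yS exy]]] := crossing_edge ce aS bS.
have cardU : #|y |: S| = #|S|.+1 by rewrite cardsU1 yS.
have /IH : (#|T| - #|y |: S| <= n)%N by rewrite cardU; lia.
have yS0 : y |: S != set0 by apply/set0Pn; exists y; rewrite setU11.
move=> /(_ yS0); apply: leq_trans; rewrite cardU.
rewrite big_setU1 //=.
have -> : (\sum_(i in S) \sum_(j in y |: S) e i j =
  \sum_(i in S) e i y + \sum_(i in S) \sum_(j in S) e i j)%N.
  by rewrite -big_split; apply: eq_bigr => i iS; rewrite big_setU1.
have p1 : (0 < \sum_(j in S) e y j)%N by rewrite (bigD1 x) //= se exy.
have p2 : (0 < \sum_(i in S) e i y)%N by rewrite (bigD1 x) //= exy.
rewrite big_setU1 //=; move: p1 p2.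
move: (\sum_(j in S) e y j)%N (\sum_(i in S) e i y)%N => p q.
by move: (\sum_(i in S) _)%N => r; case: (e y y); lia.
Qed.

(** Each vertex outside the set uses up at least one edge, so [size s] vertices span at most
    [size s] edges. A sequence is used so that the double sum unfolds on explicit vertices. *)
Lemma sparse_unicyclic e (s : seq T) : symmetric e -> spanning_connected e ->
  (\sum_x degr e x = 2 * #|T|)%N -> uniq s -> (0 < size s)%N ->
  (\sum_(x <- s) \sum_(y <- s) e x y <= 2 * size s)%N.
Proof.
move=> se ce sumd us s0.
have S0 : [set x in s] != set0.
  by case: s s0 {us} => // a s _; apply/set0Pn; exists a; rewrite inE mem_head.
have := induced_edges_le se ce S0; rewrite sumd.
have cS : #|[set x in s]| = size s by rewrite cardsE; apply/card_uniqP.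
have leT : (size s <= #|T|)%N by rewrite -cS max_card.
have E (F : T -> nat) : (\sum_(x in [set x in s]) F x = \sum_(x <- s) F x)%N.
  by rewrite [RHS]big_uniq //; apply: eq_bigl => x; rewrite inE.
by rewrite cS E; under eq_bigr do rewrite E; lia.
Qed.

Section Unicyclic.
Variable e : rel T.
Hypotheses (se : symmetric e) (ie : irreflexive e) (ce : spanning_connected e).
Hypothesis sumd : (\sum_x degr e x = 2 * #|T|)%N.

Lemma edge_neq x y : e x y -> x != y.
Proof. by move=> exy; apply/eqP => E; rewrite E ie in exy. Qed.

(** Four vertices would span at least five edges. *)
Lemma no_diamond a b x y : e a b -> x != y ->
  e a x -> e b x -> e a y -> e b y -> False.
Proof.
move=> eab xy eax ebx eay eby.
have := @sparse_unicyclic e [:: a; b; x; y] se ce sumd.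
rewrite /= !inE !negb_or xy !edge_neq //= => /(_ isT isT).
rewrite !big_cons !big_nil eab eax ebx eay eby.
rewrite (se b a) (se x a) (se x b) (se y a) (se y b) eab eax ebx eay eby !ie.
by move: (nat_of_bool (e x y)) (nat_of_bool (e y x)) => p q /=; lia.
Qed.

(** Five vertices would span at least six edges. *)
Lemma no_theta a b x y z : a != b -> x != y -> x != z -> y != z ->
  e a x -> e b x -> e a y -> e b y -> e a z -> e b z -> False.
Proof.
move=> ab xy xz yz eax ebx eay eby eaz ebz.
have := @sparse_unicyclic e [:: a; b; x; y; z] se ce sumd.
rewrite /= !inE !negb_or ab xy xz yz !edge_neq //= => /(_ isT isT).
rewrite !big_cons !big_nil eax ebx eay eby eaz ebz.
rewrite (se x a) (se x b) (se y a) (se y b) (se z a) (se z b).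
rewrite eax ebx eay eby eaz ebz !ie /=.
move: (nat_of_bool (e a b)) (nat_of_bool (e b a)) => n1 n2.
move: (nat_of_bool (e x y)) (nat_of_bool (e y x)) => n3 n4.
move: (nat_of_bool (e x z)) (nat_of_bool (e z x)) => n5 n6.
by move: (nat_of_bool (e y z)) (nat_of_bool (e z y)) => n7 n8; lia.
Qed.

End Unicyclic.

(** Adding 1 to the degree of each leaf raises the total to [2 * #|T|] plus the number of leaves,
    while every vertex other than [a] and [b] then contributes at least 2. *)
Lemma leaf_lower_bound (d : T -> nat) a b :
  (forall x, 0 < d x)%N -> (\sum_x d x = 2 * #|T|)%N -> a != b ->
  (d a + d b <= #|[set x | d x == 1%N]| + 4)%N.
Proof.
move=> dpos sumd ab.
have cL : #|[set x | d x == 1%N]| = (\sum_x (d x == 1))%N.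
  rewrite -sum1_card big_mkcond /=; apply: eq_bigr => x _; rewrite inE.
  by case: eqP.
have : (\sum_x (d x + (d x == 1)) = 2 * #|T| + #|[set x | d x == 1%N]|)%N.
  by rewrite big_split /= sumd cL.
rewrite (bigD1 a) //= (bigD1 b) 1?eq_sym //=.
have : (\sum_(i | (i != a) && (i != b)) 2 <=
        \sum_(i | (i != a) && (i != b)) (d i + (d i == 1)))%N.
  by apply: leq_sum => i _; have := dpos i; case: (d i) => [|[|k]].
rewrite sum_nat_const.
have : (2 + #|[pred i | (i != a) && (i != b)]| = #|T|)%N.
  have := cardC (pred2 a b); rewrite card2 ab => <-; congr (_ + _)%N.
  by apply: eq_card => i; rewrite !inE negb_or.
move: (\sum_(i | _) _)%N #|_| => p q.
clear; move: #|_| #|_| (nat_of_bool _) (nat_of_bool _) => t l i j; lia.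
Qed.

(** A vertex of [W] has at most [#|W|.-1] neighbours in [W], and the edges leaving [W] are bounded
    by the degrees outside, which are at most 1. With two or fewer non-leaves the degree sum would
    stay below [2 * #|T|]. *)
Lemma unicyclic_three_nonleaves e : irreflexive e -> symmetric e ->
  (\sum_x degr e x = 2 * #|T|)%N -> (0 < #|T|)%N ->
  (3 <= #|[set x | 1 < degr e x]|)%N.
Proof.
move=> ie se sumd T0; set W := [set x | _].
have cW : (#|W| + #|~: W| = #|T|)%N by rewrite cardsC.
have out : (\sum_(x in ~: W) degr e x <= #|~: W|)%N.
  rewrite -sum1_card; apply: leq_sum => x.
  by rewrite !inE -leqNgt.
have inW : (\sum_(x in W) degr e x <=
    #|W| * #|W|.-1 + \sum_(x in ~: W) degr e x)%N.
  rewrite -sum_nat_const [X in (_ + X)%N](_ : _ =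
     (\sum_(x in ~: W) \sum_y e x y)%N); last first.
    by apply: eq_bigr => x _; rewrite degr_sum.
  apply: (@leq_trans (\sum_(x in W) #|W|.-1 + \sum_(x in W) \sum_(y in ~: W) e x y)).
    rewrite -big_split /=; apply: leq_sum => x xW.
    rewrite /degr -(cardsID W) leq_add //.
      have := cardsD1 x W; rewrite xW => -> /=.
      apply: subset_leq_card; apply/subsetP => y; rewrite !inE.
      case/andP => exy ->; rewrite andbT.
      by apply/eqP => E; rewrite E ie in exy.
    rewrite -sum1_card big_mkcond [leqRHS]big_mkcond /=; apply: leq_sum => y _.
    by rewrite !inE; case: (e x y); rewrite ?andbT ?andbF //; case: ifP.
  rewrite leq_add2l exchange_big /=; apply: leq_sum => y _.
  rewrite big_mkcond /=; apply: leq_sum => x _; rewrite se.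
  by case: ifP.
have tot : (\sum_(x in W) degr e x + \sum_(x in ~: W) degr e x = 2 * #|T|)%N.
  rewrite -sumd [RHS](bigID (mem W)) /=; congr (_ + _)%N.
  by apply: eq_bigl => x; rewrite !inE.
(* This settles [W] empty, where [inW] alone leaves room for a positive sum. *)
have p0 : (\sum_(x in W) degr e x <= #|W| * #|T|)%N.
  by rewrite -sum_nat_const; apply: leq_sum => x _; apply: max_card.
move: T0 cW out inW tot p0 => {sumd}; move: #|T| => t; move: (\sum_(x in W) _)%N (\sum_(x in ~: W) _)%N => p q.
move: #|W| #|~: W| => [|[|[|k]]] m //=; lia.
Qed.

(** Meant for the change [h] in weight when only the degrees of [u] and [v] change. The link [u v]
    is kept apart because both of its ends change. *)
Lemma wsum_two_hubs (V : zmodType) (h : T -> T -> V) e u v :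
  symmetric e -> irreflexive e -> u != v -> (forall x y, h x y = h y x) ->
  (forall x y, x != u -> x != v -> y != u -> y != v -> h x y = 0) ->
  wsum h e = (\sum_(y in nbr e u :\ v) h u y + \sum_(y in nbr e v :\ u) h v y
              + (if e u v then h u v else 0)) *+ 2.
Proof.
move=> se ie uv hs h0; have vu : v != u by rewrite eq_sym.
 rewrite /wsum (bigD1 u) //= [X in _ + X = _](bigD1 v) //=.
have row a b : a != b -> \sum_(y | e a y) h a y =
    \sum_(y in nbr e a :\ b) h a y + (if e a b then h a b else 0).
  move=> ab; rewrite (bigID (pred1 b)) /= addrC; congr (_ + _).
    by apply: eq_bigl => y; rewrite !inE andbC.
  rewrite (eq_bigl (fun y => (y == b) && e a b)); last first.
    by move=> y; rewrite andbC; case: eqP => // ->.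
  by case: ifP => eab; [under eq_bigl do rewrite andbT; rewrite big_pred1_eq
    | rewrite big1 // => y; rewrite andbF].
have rest : \sum_(i | (i != u) && (i != v)) \sum_(y | e i y) h i y =
    \sum_(y in nbr e u :\ v) h u y + \sum_(y in nbr e v :\ u) h v y.
  have split x : (x != u) && (x != v) -> \sum_(y | e x y) h x y =
      (if e u x then h u x else 0) + (if e v x then h v x else 0).
    case/andP=> xu xv; rewrite big_mkcond (bigD1 u) //= (bigD1 v) //=.
    rewrite big1 ?addr0; last first.
      by move=> y /andP[yu yv]; rewrite h0 // if_same.
    by rewrite (se x u) (se x v) (hs x u) (hs x v).
  rewrite (eq_bigr _ split) big_split /=; congr (_ + _); rewrite -big_mkcondr /=.
    apply: eq_bigl => x; rewrite !inE.
    by case: (eqVneq x u) => [->|_] /=; rewrite ?ie ?andbF.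
  apply: eq_bigl => x; rewrite !inE.
  by case: (eqVneq x v) => [->|_] /=; rewrite ?ie ?andbF ?andbT.
rewrite (row u v) // (row v u) // rest (se v u) (hs v u).
move: (\sum_(y in _) _) (\sum_(y in _) _) (if _ then _ else _) => A B C.
by rewrite addrA (addrACA B C) addrAC mulr2n [RHS]addrACA.
Qed.

(** Both sums are compared with multiples of the minimum of [psi] on [A]: it bounds every [phi b],
    is positive, and occurs more often on the larger set. *)
Lemma sum_lt_of_le (R : realDomainType) (A B : {set T}) (phi psi : T -> R) :
  (#|B| < #|A|)%N -> (forall a, a \in A -> 0 < psi a) ->
  (forall a b, a \in A -> b \in B -> phi b <= psi a) ->
  \sum_(b in B) phi b < \sum_(a in A) psi a.
Proof.
move=> ltBA psi0 le_pp.
have [a0 a0A] : exists a, a \in A by apply/card_gt0P; apply: leq_ltn_trans ltBA.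
case: (@arg_minP _ _ _ a0 (mem A) psi a0A) => m mA mmin.
apply: (@le_lt_trans _ _ (\sum_(b in B) psi m)).
  by apply: ler_sum => b bB; apply: le_pp.
apply: (@lt_le_trans _ _ (\sum_(a in A) psi m)); last first.
  by apply: ler_sum => a aA; apply: mmin.
rewrite !sumr_const ltr_pMn2l ?psi0 //.
Qed.

End Counting.

(** * Majorization *)

Section Majorization.
Local Open Scope nat_scope.
Implicit Types (s t : seq nat) (j k : nat).

(* Majorization is equivalent to comparing these sums for every threshold
   [k], which makes no reference to an ordering of the entries; the
   truncation of [a - k] at [0] is intended. *)
Definition excess s k : nat := \sum_(a <- s) (a - k).

Lemma excess0 s : excess s 0 = sumn s.
Proof. by rewrite sumnE; apply: eq_bigr => a _; rewrite subn0. Qed.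

Lemma excess_pos s : all (leq 1) s -> excess s 1 + size s = sumn s.
Proof.
rewrite /excess; elim: s => [|a s IH] /=; first by rewrite big_nil.
by case/andP => a0 /IH; rewrite big_cons; lia.
Qed.

Lemma excessS s k : excess s k = excess s k.+1 + count (leq k.+1) s.
Proof.
by rewrite /excess; elim: s => [|a s IH] /=; rewrite ?big_nil // !big_cons IH; lia.
Qed.

Lemma excess_large s k : sumn s <= k -> excess s k = 0.
Proof.
by rewrite /excess; elim: s => [|a s IH] /=; rewrite ?big_nil // big_cons; lia.
Qed.

Lemma count_leqS s k : count (leq k) s = count_mem k s + count (leq k.+1) s.
Proof. by elim: s => //= a s ->; case: eqP; lia. Qed.

(** Consecutive differences of the excess count the entries above a threshold, and differences of
    these counts are the multiplicities. Equal sizes supply the count at threshold 0. *)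
Lemma perm_eq_excess s t : size s = size t -> excess s =1 excess t -> perm_eq s t.
Proof.
move=> st E; have C k : count (leq k) s = count (leq k) t.
  case: k => [|k]; last by have := excessS s k; have := excessS t k; rewrite !E; lia.
  have all0 q : count (leq 0) q = size q by elim: q => //= a q ->.
  by rewrite !all0.
apply/allP => a _; apply/eqP => /=.
by apply: (@addIn (count (leq a.+1) s)); rewrite -count_leqS !C -count_leqS.
Qed.

(** The entries above [k] form a prefix of a non-increasing sequence, and on it the subtraction is
    not truncated. *)
Lemma excess_sorted s k : sorted geq s ->
  excess s k + count (leq k.+1) s * k = sumn (take (count (leq k.+1) s) s).
Proof.
rewrite /excess; elim: s => [|a s IH] ss /=; first by rewrite big_nil.
rewrite big_cons; have ss' : sorted geq s by exact: path_sorted ss.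
have [ka|ak] := ltnP k a; first by rewrite /= -IH //; lia.
have le_k b : b \in s -> b <= k.
  move=> bs; apply: leq_trans ak.
  have : path geq a s by [].
  by rewrite path_sortedE; [case/andP => /allP/(_ _ bs) | move=> x y z /=; lia].
have -> : count (leq k.+1) s = 0.
  apply/eqP; rewrite -leqn0 leqNgt -has_count; apply/negP => /hasP[b /le_k] /=.
  by rewrite leqNgt => /negP.
rewrite /= big_seq big1; first by lia.
by move=> b /le_k; lia.
Qed.

Lemma take_le_excess t j k : sumn (take j t) <= excess t k + j * k.
Proof.
rewrite /excess; elim: t j => [|a t IH] [|j] //=.
by rewrite big_cons; have := IH j; lia.
Qed.

(** The critical prefix length [j] is the number of entries of [s] above [k]: the prefix sum of [s]
    then equals its excess plus [j * k], while that of [t] is at most its excess plus [j * k]. *)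
Lemma excess_le s t k : sorted geq s -> size s = size t ->
  (forall j, j <= size s -> sumn (take j s) <= sumn (take j t)) ->
  excess s k <= excess t k.
Proof.
move=> ss st le_st; have := excess_sorted k ss.
have := le_st _ (count_size (leq k.+1) s).
by have := take_le_excess t (count (leq k.+1) s) k; lia.
Qed.

End Majorization.

Section DegreeList.
Local Open Scope nat_scope.
Variable T : finType.
Implicit Types d : T -> nat.

Definition degree_list d : seq nat := [seq d x | x <- enum T].

Lemma size_degree_list d : size (degree_list d) = #|T|.
Proof. by rewrite size_map -cardE. Qed.

Lemma excess_degree_list d k : excess (degree_list d) k = \sum_x (d x - k).
Proof. by rewrite /excess big_map big_enum. Qed.

Lemma sumn_degree_list d : sumn (degree_list d) = \sum_x d x.
Proof. by rewrite sumnE big_map big_enum. Qed.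

Lemma count_degree_list (p : pred nat) d :
  count p (degree_list d) = #|[set x | p (d x)]|.
Proof.
rewrite count_map cardE -sum1_size -sum1_count big_enum_cond /=.
by rewrite [RHS]big_enum /=; apply: eq_bigl => x; rewrite inE.
Qed.

End DegreeList.

(** * Moving one unit of degree *)

Section LexOptimal.
Variables (T : finType) (R : realFieldType).
Implicit Types (e : rel T) (d : T -> nat) (g : T -> T -> R).

Definition feasible d e : Prop :=
  [/\ symmetric e, irreflexive e, spanning_connected e
    & forall x, degr e x = d x].

Definition lex_optimal g1 g2 d e : Prop :=
  feasible d e /\ forall e', feasible d e' -> wsum g1 e' <= wsum g1 e /\
    (wsum g1 e' = wsum g1 e -> wsum g2 e' <= wsum g2 e).

(** Relations are coded as sets of pairs, which form a finite type; the second maximum is taken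
    among the maximizers of [g1]. *)
Lemma exists_lex_optimal g1 g2 d e :
  feasible d e -> exists e', lex_optimal g1 g2 d e'.
Proof.
pose rl (A : {set T * T}) : rel T := fun x y => (x, y) \in A.
pose code e' : {set T * T} := [set p | e' p.1 p.2].
have rlK e' : rl (code e') = e'.
  by apply/funext => x; apply/funext => y; rewrite /rl inE.
move=> fe; have P0 : `[< feasible d (rl (code e)) >] by apply/asboolP; rewrite rlK.
case: (@arg_maxP _ _ _ (code e) (fun A => `[< feasible d (rl A) >])
   (fun A => wsum g1 (rl A)) P0) => A1 P1 max1.
have P1' : `[< feasible d (rl A1) >] && (wsum g1 (rl A1) == wsum g1 (rl A1)).
  by rewrite P1 eqxx.
case: (@arg_maxP _ _ _ A1 (fun A => `[< feasible d (rl A) >] &&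
   (wsum g1 (rl A) == wsum g1 (rl A1))) (fun A => wsum g2 (rl A)) P1').
move=> A2 /andP[/asboolP f2 /eqP E2] max2.
exists (rl A2); split=> // e' fe'; rewrite E2.
have f' : `[< feasible d (rl (code e')) >] by apply/asboolP; rewrite rlK.
split=> [|E]; first by have := max1 _ f'; rewrite rlK.
have f'' : `[< feasible d (rl (code e')) >] &&
    (wsum g1 (rl (code e')) == wsum g1 (rl A1)) by rewrite f' rlK E eqxx.
by have := max2 _ f''; rewrite rlK.
Qed.

End LexOptimal.

(** * Weights that depend on the degrees of the two ends *)

Section Weight.
Variables (T : finType) (R : realFieldType) (F : nat -> nat -> R).
Hypothesis F_sym : forall a b, (0 < a)%N -> (0 < b)%N -> F a b = F b a.
Hypothesis F_esc : forall a b p q, (0 < b)%N -> (b <= a)%N -> (0 < q)%N ->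
  (q <= p)%N -> F a q + F b p <= F a p + F b q.
Hypothesis F_lt : forall a b p, (0 < a)%N -> (a < b)%N -> (0 < p)%N ->
  F a p < F b p.
Hypothesis F_inc : forall a b p q, (1 < b)%N -> (b <= a)%N -> (0 < q)%N ->
  (q <= p)%N -> F b q - F b.-1 q <= F a.+1 p - F a p.
Hypothesis F_adj : forall a b q, (1 < b)%N -> (b <= a)%N -> (0 < q)%N ->
  F q b + F a b <= F a.+1 q + F a.+1 b.-1.

Definition weight (d : T -> nat) : T -> T -> R := fun x y => F (d x) (d y).

(** For distinct ranks the product is strictly escalating, so it decides switches on which [weight]
    is tied. *)
Definition rank_weight (r : T -> nat) : T -> T -> R :=
  fun x y => (r x)%:R * (r y)%:R.

Definition unit_transfer (d : T -> nat) u v : T -> nat :=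
  fun x => if x == u then (d u).+1 else if x == v then (d v).-1 else d x.

(** * Exchanges in an optimal graph *)

Section Step.
Variables (d r : T -> nat) (e : rel T).
Hypothesis dpos : forall x, (0 < d x)%N.
Hypothesis r_inj : injective r.
Hypothesis r_deg : forall x y, (d x < d y)%N -> (r x < r y)%N.
Hypothesis opt : lex_optimal (weight d) (rank_weight r) d e.

Let se : symmetric e. Proof. by case: opt => -[]. Qed.
Let ie : irreflexive e. Proof. by case: opt => -[]. Qed.
Let ce : spanning_connected e. Proof. by case: opt => -[]. Qed.
Let de x : degr e x = d x. Proof. by case: opt => -[]. Qed.

Lemma rank_degree x y : (r x < r y)%N -> (d x <= d y)%N.
Proof. by move=> rxy; rewrite leqNgt; apply/negP => /r_deg; lia. Qed.

(** If [x] had the smaller rank, escalation would make the switched graph at least as heavy, hence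
    tied with the optimum, while its rank sum would be larger by twice
    [(r u - r v) * (r y - r x)]. *)
Lemma switch_optimal u v x y : (r v < r u)%N -> x != v -> y != u ->
  e u x -> e v y -> ~~ e u y -> ~~ e v x ->
  connect (switch e u v x y) u v -> (r y < r x)%N.
Proof.
move=> rvu xv yu eux evy neuy nevx cuv.
have uv : u != v by apply/eqP => E; rewrite E ltnn in rvu.
have xu : x != u by apply/eqP => E; rewrite E ie in eux.
have yv : y != v by apply/eqP => E; rewrite E ie in evy.
have xy : x != y by apply/eqP => E; rewrite E (negPf neuy) in eux.
rewrite ltnNge; apply/negP; rewrite leq_eqVlt => /orP[/eqP/r_inj/eqP|rxy].
  by rewrite (negPf xy).
have fs : feasible d (switch e u v x y).
  split; first exact: switch_sym.
  - exact: switch_irr.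
  - exact: switch_connected.
  - by move=> z; rewrite degr_switch.
have [le1 le2] := opt.2 _ fs.
have eq1 := wsum_switch se ie uv xv yu eux evy neuy nevx (weight d).
have eq2 := wsum_switch se ie uv xv yu eux evy neuy nevx (rank_weight r).
have esc := F_esc (dpos v) (rank_degree rvu) (dpos x) (rank_degree rxy).
have s1 := F_sym (dpos u) (dpos x); have s2 := F_sym (dpos v) (dpos y).
have s3 := F_sym (dpos u) (dpos y); have s4 := F_sym (dpos v) (dpos x).
have E1 : wsum (weight d) (switch e u v x y) = wsum (weight d) e.
  by apply/eqP; rewrite eq_le le1 /=; move: eq1; rewrite /weight; lra.
have := le2 E1; move: eq2; rewrite /rank_weight.
have : 0 < ((r u)%:R - (r v)%:R) * ((r y)%:R - (r x)%:R) :> R.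
  by rewrite mulr_gt0 // subr_gt0 ltr_nat.
by move: (wsum _ _) (wsum _ _) => A B; nra.
Qed.

Section Hubs.
Variables u v : T.
Hypotheses (uv : u != v) (duv : (d v <= d u)%N) (dv : (1 < d v)%N).
Hypothesis rvu : (r v < r u)%N.

Let vu : v != u. Proof. by rewrite eq_sym. Qed.
Let uvF : (u == v) = false. Proof. exact: negPf. Qed.
Let vuF : (v == u) = false. Proof. exact: negPf. Qed.

Let d' := unit_transfer d u v.

Lemma unit_transfer_gt0 x : (0 < d' x)%N.
Proof.
rewrite /d' /unit_transfer; case: ifP => // _; case: ifP => // _.
by rewrite -subn1 subn_gt0.
Qed.

Lemma unit_transfer_u : d' u = (d u).+1.
Proof. by rewrite /d' /unit_transfer eqxx. Qed.

Lemma unit_transfer_v : d' v = (d v).-1.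
Proof. by rewrite /d' /unit_transfer vuF eqxx. Qed.

Lemma unit_transfer_off x : x != u -> x != v -> d' x = d x.
Proof. by rewrite /d' /unit_transfer => /negPf-> /negPf->. Qed.

Lemma degr_transfer w x : e v w -> ~~ e u w -> w != u ->
  degr (transfer e u v w) x = d' x.
Proof.
move=> evw neuw wu.
have vw : v != w by apply/eqP => E; rewrite E ie in evw.
rewrite /transfer degr_add_edge; first last.
- by rewrite /del_edge (negPf neuw).
- exact: del_edge_sym.
- by rewrite eq_sym.
have := degr_del_edge x vw se evw; rewrite de.
rewrite /d' /unit_transfer !(eq_sym x).
have [ux|ux] := eqVneq u x.
  by rewrite -ux vuF (negPf wu); lia.
by have [<-|vx] := eqVneq v x; rewrite 1?eq_sym ?(negPf vw); lia.
Qed.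

(** The edges stay fixed and only the degrees are revised: re-attaching an edge is split into
    deleting it, revising degrees, and adding it in its new place. *)
Lemma wsum_unit_transfer (e' : rel T) : symmetric e' -> irreflexive e' ->
  wsum (weight d') e' = wsum (weight d) e' +
  (\sum_(y in nbr e' u :\ v) (F (d u).+1 (d y) - F (d u) (d y)) -
   \sum_(y in nbr e' v :\ u) (F (d v) (d y) - F (d v).-1 (d y)) +
   (if e' u v then F (d u).+1 (d v).-1 - F (d u) (d v) else 0)) *+ 2.
Proof.
move=> se' ie'; pose h x y := weight d' x y - weight d x y.
have -> : wsum (weight d') e' = wsum (weight d) e' + wsum h e'.
  rewrite /wsum -big_split; apply: eq_bigr => x _.
  by rewrite -big_split; apply: eq_bigr => y _; rewrite /= /h addrC subrK.
rewrite (@wsum_two_hubs _ _ h e' u v se' ie' uv); first last.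
- by move=> x y xu xv yu yv; rewrite /h /weight !unit_transfer_off ?subrr.
- by move=> x y; rewrite /h /weight F_sym ?unit_transfer_gt0 // (@F_sym (d x)).
rewrite /h /weight unit_transfer_u unit_transfer_v; congr (_ + _ *+ 2).
congr (_ + _ + _).
- apply: eq_bigr => y; rewrite !inE => /andP[yv euy]; rewrite unit_transfer_off //.
  by apply/eqP => E; rewrite E ie' in euy.
- rewrite -sumrN; apply: eq_bigr => y; rewrite !inE => /andP[yu evy].
  rewrite unit_transfer_off ?opprB //.
  by apply/eqP => E; rewrite E ie' in evy.
Qed.

Lemma transfer_gain w : e v w -> ~~ e u w -> w != u ->
  \sum_(y in nbr e v :\ u :\ w) (F (d v) (d y) - F (d v).-1 (d y)) <
  \sum_(y in nbr e u :\ v) (F (d u).+1 (d y) - F (d u) (d y)) ->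
  wsum (weight d) e < wsum (weight d') (transfer e u v w).
Proof.
move=> evw neuw wu lt_sums.
have vw : v != w by apply/eqP => E; rewrite E ie in evw.
have sd : symmetric (del_edge e v w) by apply: del_edge_sym.
have id : irreflexive (del_edge e v w) by apply: del_edge_irr.
rewrite /transfer wsum_add_edge //; first last.
- by rewrite /del_edge (negPf neuw).
- by rewrite eq_sym.
rewrite (wsum_unit_transfer sd id) (wsum_del_edge (weight d) vw se evw).
have -> : nbr (del_edge e v w) u :\ v = nbr e u :\ v.
  apply/setP => y; rewrite !inE /del_edge /pair_rel uvF eq_sym (eq_sym u w).
  by rewrite (negPf wu) andbT.
have -> : nbr (del_edge e v w) v :\ u = nbr e v :\ u :\ w.
  apply/setP => y; rewrite !inE /del_edge /pair_rel eqxx /= (negPf vw) orbF.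
  by rewrite andbA [RHS]andbC.
have -> : del_edge e v w u v = e u v.
  by rewrite /del_edge /pair_rel uvF (eq_sym u w) (negPf wu) andbT.
have wv : w != v by rewrite eq_sym.
rewrite /weight unit_transfer_u (unit_transfer_off wu wv).
have := F_sym (ltn0Sn (d u)) (dpos w); have := F_sym (dpos v) (dpos w).
move: lt_sums; move: (\sum_(y in _) _) (\sum_(y in _) _) (wsum _ _) => A B W.
(* If [u v] is an edge, [F_adj] accounts jointly for it and the moved edge; otherwise the moved edge
   gains by monotonicity. *)
case: ifP => [euv|_] lt_sums s1 s2.
  by have := F_adj dv duv (dpos w); rewrite mulr2n; lra.
have lt1 : F (d v) (d w) < F (d u).+1 (d w) by apply: F_lt.
by rewrite mulr2n; lra.
Qed.

Let step_goal := exists e' : rel T,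
  feasible d' e' /\ wsum (weight d) e < wsum (weight d') e'.

Lemma transfer_step w : e v w -> ~~ e u w -> w != u ->
  connect (transfer e u v w) u v ->
  \sum_(y in nbr e v :\ u :\ w) (F (d v) (d y) - F (d v).-1 (d y)) <
  \sum_(y in nbr e u :\ v) (F (d u).+1 (d y) - F (d u) (d y)) -> step_goal.
Proof.
move=> evw neuw wu cuv lt_sums; exists (transfer e u v w).
have wv : w != v by apply/eqP => E; rewrite E ie in evw.
split; last exact: transfer_gain.
split; first by apply: add_edge_sym; apply: del_edge_sym.
- by apply: add_edge_irr; [rewrite eq_sym | apply: del_edge_irr].
- exact: transfer_connected.
- by move=> x; apply: degr_transfer.
Qed.

Lemma degree_gain_gt0 p : (0 < p)%N -> 0 < F (d u).+1 p - F (d u) p.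
Proof. by move=> p0; rewrite subr_gt0 F_lt. Qed.

(** The link survives every switch of private neighbours, so those of [u] dominate those of [v].
    After [w] has left, [v] has strictly fewer private neighbours than [u], which makes the gain
    strict. *)
Lemma linked_step w : e u v \/ (exists2 c, e u c & e v c) ->
  e v w -> ~~ e u w -> w != u -> step_goal.
Proof.
move=> link evw neuw wu.
have wv : w != v by apply/eqP => E; rewrite E ie in evw.
have valid x y : x \in nbr e u :\ v :\: nbr e v ->
    y \in nbr e v :\ u :\: nbr e u -> (d y <= d x)%N.
  rewrite !inE => /andP[nevx /andP[xv eux]] /andP[neuy /andP[yu evy]].
  apply: rank_degree; apply: (@switch_optimal u v) => //.
  case: link => [euv|[c euc evc]].
    apply: connect1; apply: switch_keep => //.
      by rewrite /pair_rel (eq_sym v x) (negPf xv) vuF !andbF.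
    by rewrite /pair_rel (eq_sym u y) uvF (negPf yu).
  have cu : c != u by apply/eqP => E; rewrite E ie in euc.
  have cv : c != v by apply/eqP => E; rewrite E ie in evc.
  have cx : c != x by apply/eqP => E; rewrite -E evc in nevx.
  have cy : c != y by apply/eqP => E; rewrite -E euc in neuy.
  apply: (@connect_trans _ _ c); apply: connect1; apply: switch_keep;
  by rewrite // ?(se c v) // /pair_rel ?(negPf cu) ?(negPf cv) ?(negPf cx)
    ?(negPf cy) ?uvF ?vuF ?andbF.
apply: (@transfer_step w) => //.
  have wc c : e u c -> c != w by move=> euc; apply/eqP => E; rewrite -E euc in neuw.
  case: link => [euv|[c euc evc]].
    apply: connect1; rewrite /transfer /add_edge /del_edge euv /pair_rel.
    by rewrite uvF (eq_sym u w) (negPf wu).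
  have cv : c != v by apply/eqP => E; rewrite E ie in evc.
  apply: (@connect_trans _ _ c); apply: connect1;
  rewrite /transfer /add_edge /del_edge /pair_rel ?euc ?(se c v) ?evc;
  by rewrite ?(negPf (wc _ euc)) ?(negPf cv) ?uvF ?(eq_sym u w) ?(negPf wu).
(* Common neighbours are compared with themselves; [valid] compares the private ones. *)
pose C := nbr e u :&: nbr e v.
rewrite (big_setID C) [ltRHS](big_setID C) /=.
have EA : (nbr e v :\ u :\ w) :&: C = C.
  apply/setP => y; rewrite !inE; case: (eqVneq y w) => [->|_] /=.
    by rewrite (negPf neuw).
  by case: (eqVneq y u) => [->|_] /=; rewrite ?ie // andbA andbAC andbb andbC.
have EB : (nbr e u :\ v) :&: C = C.
  apply/setP => y; rewrite !inE; case: (eqVneq y v) => [->|_] /=.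
    by rewrite ie andbF.
  by rewrite andbA andbb.
have cA := cardsID C (nbr e v :\ u :\ w); have cB := cardsID C (nbr e u :\ v).
have c1 := cardsD1 v (nbr e u); have c2 := cardsD1 u (nbr e v).
have c3 := cardsD1 w (nbr e v :\ u).
have d1 := de u; have d2 := de v; rewrite /degr in d1 d2.
have in_w : w \in nbr e v :\ u by rewrite !inE wu evw.
have e_uv : (u \in nbr e v) = (v \in nbr e u) by rewrite !inE se.
rewrite in_w in c3; rewrite e_uv in c2.
rewrite EA in cA *; rewrite EB in cB *.
apply: ler_ltD.
  by apply: ler_sum => y _; apply: F_inc.
apply: sum_lt_of_le => [|x _|x y xA yB].
- by move: cA cB c1 c2 c3 d1 d2 duv; clear; lia.
- exact: degree_gain_gt0.
apply: F_inc => //; apply: valid.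
  move: xA; rewrite !inE => /andP[nC /andP[xv eux]].
  by move: nC; rewrite eux /= => ->; rewrite xv.
move: yB; rewrite !inE => /andP[nC /and3P[yw yu evy]].
by move: nC; rewrite evy andbT => ->; rewrite yu.
Qed.

Definition off_hubs : rel T :=
  fun a b => [&& e a b, a != u, a != v, b != u & b != v].

(** [S] is [u] with everything reached from its neighbours while avoiding both hubs; an edge leaving
    [S] can only end in [v]. *)
Lemma linking_path : ~~ e u v ->
  exists x y, [/\ e u x, e v y & connect off_hubs x y].
Proof.
move=> neuv.
pose S := [set z | (z == u) || [&& z != u, z != v &
  [exists x, e u x && connect off_hubs x z]]].
have uS : u \in S by rewrite inE eqxx.
have vS : v \notin S by rewrite inE vuF eqxx.
have [x [y [xS yS exy]]] := crossing_edge ce uS vS.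
have yu : y != u by apply/eqP => E; rewrite E uS in yS.
move: xS; rewrite inE => /orP[/eqP xu|/and3P[xu xv /existsP[x0 /andP[eux0 cx]]]].
  have yv : y != v by apply/eqP => E; rewrite -E -xu exy in neuv.
  case/negP: yS; rewrite inE yu yv /= (negPf yu) /=; apply/existsP; exists y.
  by rewrite -xu exy connect0.
have [yv|yv] := eqVneq y v; first by exists x0, x; split; rewrite // se -yv.
case/negP: yS; rewrite inE yu yv (negPf yu) /=; apply/existsP; exists x0.
rewrite eux0 /=; apply: connect_trans cx (connect1 _).
by rewrite /off_hubs exy xu xv yu yv.
Qed.

(** A path from [x0] to [y0] off the hubs is the connection that exchanges must preserve. So [x0] is
    compared with [y0], and the other neighbours of [u] with the other neighbours of [v]. *)
Lemma unlinked_step : ~~ e u v -> (forall c, e u c -> ~~ e v c) -> step_goal.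
Proof.
move=> neuv nocom; have [x0 [y0 [eux0 evy0 c0]]] := linking_path neuv.
have nevu : ~~ e v u by rewrite se.
have nbu x : e u x -> x != u /\ x != v.
  by move=> eux; split; apply/eqP => E; rewrite E ?ie // (negPf neuv) in eux.
have nbv y : e v y -> y != u /\ y != v.
  by move=> evy; split; apply/eqP => E; rewrite E ?ie // (negPf nevu) in evy.
have nocom' c : e v c -> ~~ e u c by apply: contraL => /nocom.
have sub x y : subrel off_hubs (switch e u v x y).
  move=> a b /and5P[eab au av bu bv]; apply: switch_keep => //;
  by rewrite /pair_rel ?(negPf au) ?(negPf av) ?(negPf bu) ?(negPf bv) ?andbF.
have subc x y : connect (switch e u v x y) x0 y0.
  by apply: connect_sub c0 => a b /sub /connect1.
have [x0u x0v] := nbu _ eux0; have [y0u y0v] := nbv _ evy0.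
(* Switching [u x0] and [v y0] leaves the hubs connected by the same path run backwards, from [u] to
   [y0] and from [x0] to [v]. *)
have valid0 : (d y0 <= d x0)%N.
  apply: rank_degree; apply: (@switch_optimal u v) => //;
    [exact: nocom'|exact: nocom|].
  apply: (@connect_trans _ _ y0).
    by apply: connect1; rewrite /switch /add_edge /pair_rel !eqxx !orbT.
  rewrite sym_connect_sym; last exact: switch_sym.
  apply: connect_trans (subc _ _); apply: connect1.
  by rewrite /switch /add_edge /pair_rel !eqxx !orbT.
(* Here the path and its edges to the hubs are untouched. *)
have valid x y : e u x -> e v y -> x != x0 -> y != y0 -> (d y <= d x)%N.
  move=> eux evy xx0 yy0; have [xu xv] := nbu _ eux; have [yu yv] := nbv _ evy.
  apply: rank_degree; apply: (@switch_optimal u v) => //;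
    [exact: nocom'|exact: nocom|].
  apply: (@connect_trans _ _ x0).
    apply: connect1; apply: switch_keep => //; rewrite /pair_rel ?uvF;
    by rewrite ?(eq_sym x0 x) ?(negPf xx0) ?(negPf x0u) ?(negPf x0v) ?andbF.
  apply: connect_trans (subc _ _) _; apply: connect1; apply: switch_keep.
  - by rewrite se.
  - by rewrite /pair_rel vuF (negPf y0u) ?andbF.
  - by rewrite /pair_rel (negPf y0v) (eq_sym y0 y) (negPf yy0).
(* Moving a neighbour other than [y0], which exists by [1 < d v], keeps the path intact. *)
have [w evw wy0] : exists2 w, e v w & w != y0.
  have : (0 < #|nbr e v :\ y0|)%N.
    have := cardsD1 y0 (nbr e v); have := de v; rewrite /degr => ->.
    by rewrite inE evy0; move: dv; clear; lia.
  by case/card_gt0P => w; rewrite !inE => /andP[wy0 evw]; exists w.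
have [wu wv] := nbv _ evw.
apply: (@transfer_step w) => //; first exact: nocom'.
  apply: (@connect_trans _ _ x0).
    apply: connect1; rewrite /transfer /add_edge /del_edge eux0 /pair_rel.
    by rewrite uvF (negPf x0v) ?andbF.
  apply: (@connect_trans _ _ y0).
    apply: connect_sub c0 => a b /and5P[eab au av bu bv]; apply: connect1.
    by rewrite /transfer /add_edge /del_edge eab /pair_rel (negPf av) (negPf bv) andbF.
  apply: connect1; rewrite /transfer /add_edge /del_edge se evy0 /pair_rel.
  by rewrite (negPf y0v) (eq_sym y0 w) (negPf wy0).
have in_y0 : y0 \in nbr e v :\ u :\ w.
  by rewrite !inE evy0 y0u eq_sym wy0.
have in_x0 : x0 \in nbr e u :\ v by rewrite !inE eux0 x0v.
(* The pair [x0], [y0] is matched off; of the rest, [u] has [d u - 1] neighbours and [v], without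
   [w], only [d v - 2]. *)
rewrite (big_setD1 y0) //= [ltRHS](big_setD1 x0) //=.
apply: ler_ltD; first exact: F_inc.
have c1 := cardsD1 v (nbr e u); have c2 := cardsD1 u (nbr e v).
have c3 := cardsD1 w (nbr e v :\ u); have c4 := cardsD1 x0 (nbr e u :\ v).
have c5 := cardsD1 y0 (nbr e v :\ u :\ w).
have in_w : w \in nbr e v :\ u by rewrite !inE wu evw.
have vN : (v \in nbr e u) = false by rewrite inE; apply: negPf.
have uN : (u \in nbr e v) = false by rewrite inE; apply: negPf.
have d1 := de u; have d2 := de v; rewrite /degr in d1 d2.
rewrite in_w in c3; rewrite in_x0 in c4; rewrite in_y0 in c5.
rewrite uN in c2; rewrite vN in c1.
apply: sum_lt_of_le => [|x _|x y].
- by move: c1 c2 c3 c4 c5 d1 d2 duv; clear; lia.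
- exact: degree_gain_gt0.
rewrite !inE => /and3P[xx0 xv eux] /and4P[yy0 yw yu evy].
by apply: F_inc => //; apply: valid.
Qed.

Lemma two_nbrs a x y : e a x -> e a y -> x != y -> (1 < d a)%N.
Proof.
move=> eax eay xy; rewrite -de /degr; apply/card_gt1P; exists x, y.
by split; rewrite ?inE.
Qed.

Lemma leaf_nbr_uniq l x y : d l = 1%N -> e l x -> e l y -> x = y.
Proof.
move=> dl elx ely; apply/eqP; apply/negPn/negP => xy.
by have := two_nbrs elx ely xy; rewrite dl.
Qed.

Lemma leaf_nbrs_card a (s : seq T) : uniq s -> {subset s <= nbr e a} ->
  (forall x, x \in s -> (1 < d x)%N) ->
  (#|nbr e a :&: [set x | d x == 1%N]| + size s <= d a)%N.
Proof.
move=> us sub ns; rewrite -de /degr -(card_uniqP us) -cardUI.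
rewrite [X in (_ + X)%N](_ : _ = 0%N) ?addn0; last first.
  apply: eq_card0 => x; rewrite !inE; apply/negP => /andP[/andP[_ /eqP dx] xs].
  by have := ns _ xs; rewrite dx.
apply: subset_leq_card; apply/subsetP => x; rewrite !inE => /orP[/andP[]//|/sub].
by rewrite inE.
Qed.

(** * The case where no neighbour of [v] can be moved *)

Section Degenerate.
Hypothesis sumd : (\sum_x d x = 2 * #|T|)%N.
Hypothesis v_min : forall z, z != v -> (d v <= d z)%N -> (r v < r z)%N.
Hypothesis four : d v = 2 -> (3 < #|[set x | 1 < d x]|)%N.
Hypothesis nbr_v : forall w, e v w -> (w == u) || e u w.

Let sumde : (\sum_x degr e x = 2 * #|T|)%N.
Proof. by rewrite -sumd; apply: eq_bigr => x _; rewrite de. Qed.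

(* Otherwise exchanging the edges [v s] and [z l] would increase the weight. *)
Lemma leaf_nbr_near s t l z : d v = 2 -> e v s -> e v t -> s != t ->
  (1 < d s)%N -> (1 < d t)%N ->
  e s t \/ (exists2 q, q != v & e s q /\ e q t) ->
  d l = 1%N -> e z l -> (z == s) || e z s.
Proof.
move=> dv2 evs evt st ds dt link dl ezl.
apply/negPn/negP => /norP[zs nezs].
have ne x y : e x y -> x != y by move=> exy; apply/eqP => E; rewrite E ie in exy.
have nl x : (1 < d x)%N -> x != l by move=> dx; apply/eqP => E; rewrite E dl in dx.
have [sl tl vl] := And3 (nl _ ds) (nl _ dt) (nl _ dv).
have nevl : ~~ e v l.
  apply/negP => evl; have := de v; rewrite dv2 /degr => c2.
  have : (2 < #|nbr e v|)%N.
    by apply/card_gt2P; exists s, t, l; split; split; rewrite ?inE // eq_sym.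
  by rewrite c2.
have zv : z != v by apply/eqP => E; rewrite -E ezl in nevl.
(* Otherwise [z] and [l] would form a component by themselves. *)
have dz : (1 < d z)%N.
  rewrite ltnNge; apply/negP => dz1.
  have dz : d z = 1%N by apply/eqP; rewrite eqn_leq dz1 dpos.
  have vS : v \notin [set z; l] by rewrite !inE negb_or eq_sym zv vl.
  have [x [y [xS yS exy]]] := crossing_edge ce (set21 z l) vS.
  case/negP: yS; move: xS exy; rewrite !inE => /orP[]/eqP-> E.
    by rewrite (leaf_nbr_uniq dz E ezl) eqxx orbT.
  by rewrite se in ezl; rewrite (leaf_nbr_uniq dl E ezl) eqxx.
(* With [z] as the hub of higher rank, optimality would rank [s] below the leaf [l], against their
   degrees. *)
have := @switch_optimal z v l s (v_min zv _); rewrite dv2 => /(_ dz).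
rewrite (eq_sym l v) (eq_sym s z) => /(_ vl zs ezl evs nezs nevl).
have : (r l < r s)%N by apply: r_deg; rewrite dl.
suff cc : connect (switch e z v l s) z v.
  by move=> lt1 /(_ cc) lt2; have := ltn_trans lt1 lt2; rewrite ltnn.
have kp a b : e a b -> a != l -> b != l -> a != v -> b != v ->
    switch e z v l s a b.
  move=> eab al bl av bv; apply: switch_keep => //;
  by rewrite /pair_rel ?(negPf al) ?(negPf bl) ?(negPf av) ?(negPf bv) ?andbF.
have [sv tv] : s != v /\ t != v by rewrite !(eq_sym _ v) !ne.
apply: (@connect_trans _ _ s).
  by apply: connect1; rewrite /switch /add_edge /pair_rel !eqxx !orbT.
apply: (@connect_trans _ _ t).
  case: link => [est|[q qv [esq eqt]]]; first by apply: connect1; apply: kp.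
  have ql : q != l by apply: nl; apply: two_nbrs eqt st; rewrite se.
  by apply: (@connect_trans _ _ q); apply: connect1; apply: kp.
apply: connect1; apply: switch_keep; first by rewrite se.
  by rewrite /pair_rel (negPf tl) (negPf vl) ?andbF.
by rewrite /pair_rel (negPf tv) (eq_sym t s) (negPf st).
Qed.

Lemma exists_nbr l : exists z, e z l.
Proof.
have : (0 < #|nbr e l|)%N by have := de l; rewrite /degr => ->.
by case/card_gt0P => z; rewrite inE => elz; exists z; rewrite se.
Qed.

(** Here [v] has degree 2 and lies on a triangle with [u] and [c], all leaves hang at [u] or [c],
    and by [four] a further non-leaf is attached there. This leaves at most [d u + d c - 5] leaves,
    against the lower bound [d u + d c - 4]. *)
Lemma no_degenerate_triangle : e u v -> False.
Proof.
move=> euv; have evu : e v u by rewrite se.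
have c1 := cardsD1 u (nbr e v); rewrite inE evu -/(degr e v) de in c1.
have [gt1|le1] := ltnP 1 #|nbr e v :\ u|.
  case/card_gt1P: gt1 => x [y []]; rewrite !inE => /andP[xu evx] /andP[yu evy] xy.
  have := nbr_v evx; have := nbr_v evy; rewrite (negPf xu) (negPf yu) /= => euy eux.
  exact: (no_diamond se ie ce sumde euv xy eux evx euy evy).
have dv2 : d v = 2 by move: c1 le1 dv; clear; lia.
have /eqP/cards1P[c Ec] : #|nbr e v :\ u| = 1%N by move: c1 le1 dv; clear; lia.
have : c \in nbr e v :\ u by rewrite Ec set11.
rewrite !inE => /andP[cu evc].
have euc : e u c by have := nbr_v evc; rewrite (negPf cu).
have ecu : e c u by rewrite se.
have ecv : e c v by rewrite se.
have [uc vc cv] : [/\ u != c, v != c & c != v].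
  by split; apply/eqP => E; rewrite ?E ?ie // -?E ?ie // in euc evc.
have du : (1 < d u)%N by exact: two_nbrs euv euc vc.
have dc : (1 < d c)%N by exact: two_nbrs ecu ecv uv.
have Nv y : e v y -> (y == u) || (y == c).
  move=> evy; have [//|yu] := eqVneq y u.
  have : y \in nbr e v :\ u by rewrite !inE yu.
  by rewrite Ec inE.
(* Any other neighbour [z] of a leaf would be adjacent to both [u] and [c] and form a diamond with
   [v] on the edge [u c]. *)
have near l z : d l = 1%N -> e z l -> (z == u) || (z == c).
  move=> dl ezl; apply/negPn/negP => /norP[zu zc].
  have := leaf_nbr_near dv2 evu evc uc du dc (or_introl euc) dl ezl.
  have := leaf_nbr_near dv2 evc evu cu dc du (or_introl ecu) dl ezl.
  rewrite (negPf zu) (negPf zc) /= => ezc ezu.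
  have vz : v != z.
    apply/eqP => E; move: ezl; rewrite -E => /Nv.
    by case/orP => /eqP E'; move: dl du dc; rewrite E'; clear; lia.
  by apply: (no_diamond se ie ce sumde euc vz) => //; rewrite se.
pose L := [set x | d x == 1%N].
have cL : (#|L| <= #|nbr e u :&: L| + #|nbr e c :&: L|)%N.
  apply: leq_trans (leq_card_setU _ _); apply: subset_leq_card.
  apply/subsetP => l; rewrite !inE => /eqP dl; have [z ezl] := exists_nbr l.
  by case/orP: (near _ _ dl ezl) => /eqP zE; rewrite -zE ezl dl eqxx ?orbT.
have lb := leaf_lower_bound dpos sumd uc.
have [z0] : exists z0, z0 \notin [set u; v; c] :|: L.
  apply/existsP; rewrite -negb_forall; apply/negP => /forallP allS.
  have : (#|[set x | 1 < d x]| <= #|[set u; v; c]|)%N.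
    apply: subset_leq_card; apply/subsetP => x; rewrite inE => dx.
    have := allS x; rewrite inE => /orP[//|]; rewrite inE => /eqP dx1.
    by rewrite dx1 in dx.
  have := four dv2; have := cardsU1 c [set u; v]; rewrite setUC => ->.
  by rewrite cards2; case: (_ \notin _); case: (_ != _) => /=; clear; lia.
move=> z0S.
have uS : u \in [set u; v; c] :|: L by rewrite !inE eqxx.
have [x [y [xS yS exy]]] := crossing_edge ce uS z0S.
move: yS; rewrite !inE !negb_or -!andbA => /and4P[yu yv yc yL].
have dy : (1 < d y)%N by have := dpos y; move: yL; clear; lia.
have uv_seq : uniq [:: u; v] by rewrite /= inE uv.
have vc_seq : uniq [:: v; c] by rewrite /= inE vc.
have bu : (#|nbr e u :&: L| + 2 <= d u)%N.
  apply: (@leaf_nbrs_card u [:: v; c]) => // w; rewrite !inE;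
  by case/orP => /eqP->.
have bc : (#|nbr e c :&: L| + 2 <= d c)%N.
  apply: (@leaf_nbrs_card c [:: u; v]) => // w; rewrite !inE;
  by case/orP => /eqP->.
(* The non-leaf [y] takes a third place at [u] or [c]; neighbours of [v] and of leaves lie in [u],
   [c]. *)
move: xS; rewrite !inE -!orbA => /or4P[]/eqP xE.
- have : (#|nbr e u :&: L| + 3 <= d u)%N.
    apply: (@leaf_nbrs_card u [:: y; v; c]) => [|w|w]; rewrite ?inE.
    + by rewrite /= !inE negb_or yv yc vc.
    + by case/or3P => /eqP->; rewrite // -xE.
    + by case/or3P => /eqP->.
  by move: cL lb bc; rewrite -/L; clear; lia.
- by move: exy; rewrite xE => /Nv; rewrite (negPf yu) (negPf yc).
- have : (#|nbr e c :&: L| + 3 <= d c)%N.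
    apply: (@leaf_nbrs_card c [:: y; u; v]) => [|w|w]; rewrite ?inE.
    + by rewrite /= !inE negb_or yu yv uv.
    + by case/or3P => /eqP->; rewrite // -xE.
    + by case/or3P => /eqP->.
  by move: cL lb bu; rewrite -/L; clear; lia.
- by rewrite se in exy; have := near _ _ xE exy; rewrite (negPf yu) (negPf yc).
Qed.

(** Turns the 4-cycle [u], [c1], [v], [c2] into the triangle [u], [c1], [c2] and, when [d v = 2],
    makes [v] pendant at [u]. *)
Definition close_square c1 c2 : rel T :=
  add_edge (add_edge (del_edge (del_edge e v c1) v c2) u v) c1 c2.

Lemma square_step c1 c2 : d v = 2 -> ~~ e u v -> c1 != c2 ->
  e u c1 -> e u c2 -> e v c1 -> e v c2 -> ~~ e c1 c2 ->
  d c1 = 2 -> d c2 = 2 -> step_goal.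
Proof.
move=> dv2 neuv c12 euc1 euc2 evc1 evc2 nec dc1 dc2.
have ne x y : e x y -> x != y by move=> exy; apply/eqP => E; rewrite E ie in exy.
have [uc1 uc2 vc1 vc2] := And4 (ne _ _ euc1) (ne _ _ euc2) (ne _ _ evc1) (ne _ _ evc2).
pose e1 := del_edge e v c1; pose e2 := del_edge e1 v c2.
pose e3 := add_edge e2 u v.
have s1 : symmetric e1 by apply: del_edge_sym.
have s2 : symmetric e2 by apply: del_edge_sym.
have s3 : symmetric e3 by apply: add_edge_sym.
have i2 : irreflexive e2 by do 2!apply: del_edge_irr.
have e1vc2 : e1 v c2.
  by rewrite /e1 /del_edge evc2 /pair_rel (negPf vc1) (eq_sym c2) (negPf c12) andbF.
have e2uv : ~~ e2 u v by rewrite /e2 /e1 /del_edge (negPf neuv).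
have e3c : ~~ e3 c1 c2.
  rewrite /e3 /e2 /e1 /add_edge /del_edge (negPf nec) /pair_rel /=.
  by rewrite (eq_sym c1) (negPf uc1) (eq_sym c1) (negPf vc1).
have Nv y : e v y -> (y == c1) || (y == c2).
  move=> evy; apply/negPn/negP => /norP[yc1 yc2].
  have : (2 < #|nbr e v|)%N.
    by apply/card_gt2P; exists c1, c2, y; split; split; rewrite ?inE // eq_sym.
  by have := de v; rewrite /degr => ->; rewrite dv2.
exists (close_square c1 c2); rewrite /close_square -/e1 -/e2 -/e3.
have s4 : symmetric (add_edge e3 c1 c2) by apply: add_edge_sym.
split; first split => //.
- by apply: add_edge_irr => //; apply: add_edge_irr.
- apply: (@hub_connected _ e _ u v) => //.
  + apply: connect1; rewrite /add_edge /e3 /add_edge /pair_rel !eqxx.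
    by rewrite ?orbT.
  + move=> x y xu xv yu yv exy; rewrite /e3 /e2 /e1 /add_edge /del_edge exy.
    by rewrite /pair_rel (negPf xv) (negPf yv) ?andbF.
  + move=> z zu zv ez; have euz : e u z.
      by case/orP: ez => // /nbr_v; rewrite (negPf zu).
    rewrite /e3 /e2 /e1 /add_edge /del_edge euz /pair_rel (negPf uv).
    by rewrite (negPf uc1) (negPf uc2) ?andbF.
- move=> z; rewrite degr_add_edge // degr_add_edge //.
  have := degr_del_edge z vc1 se evc1; have := degr_del_edge z vc2 s1 e1vc2.
  rewrite -/e1 -/e2 de /d' /unit_transfer !(eq_sym z) => E1.
  rewrite E1; have [uz|uz] := eqVneq u z.
    by rewrite -uz vuF; move: (degr e2 u) (_ == _) (_ == _) => a [] []; clear; lia.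
  have [vz|vz] := eqVneq v z; last first.
    by move: (degr e2 z) (_ == _) (_ == _) => a [] []; clear; lia.
  rewrite -vz !(eq_sym _ v) (negPf vc1) (negPf vc2).
  by move: (degr e2 v) (d v); clear; lia.
rewrite wsum_add_edge // wsum_add_edge // (wsum_unit_transfer s2 i2).
rewrite (wsum_del_edge (weight d) vc1 se evc1) -/e1.
rewrite (wsum_del_edge (weight d) vc2 s1 e1vc2) -/e2 (negPf e2uv).
(* In [e2] the vertex [v] has lost both neighbours. *)
rewrite [X in _ - X](_ : _ = 0); last first.
  apply: big1 => y; rewrite !inE /e2 /e1 /del_edge => /andP[_].
  case/andP => /andP[/Nv Ny]; rewrite /pair_rel eqxx /=.
  by case/orP: Ny => /eqP->; rewrite eqxx.
have -> : nbr e2 u :\ v = nbr e u.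
  apply/setP => y; rewrite !inE /e2 /e1 /del_edge /pair_rel uvF.
  rewrite (negPf uc1) (negPf uc2) !andbT.
  by case: (eqVneq y v) => [->|//]; rewrite (negPf neuv).
rewrite (big_setD1 c1) ?inE //= (big_setD1 c2) ?inE ?euc2 ?andbT 1?eq_sym //=.
set P := \sum_(i in _) _.
have P0 : 0 <= P by apply: sumr_ge0 => y _; apply: ltW; apply: degree_gain_gt0.
rewrite /weight unit_transfer_u unit_transfer_v.
rewrite !unit_transfer_off 1?eq_sym // dc1 dc2 dv2 /=.
have du : (1 < d u)%N by apply: leq_trans dv duv.
(* The net loss of one edge of weight [F 2 2] is covered by the new edge [u v] and the rise of one
   of [u c1], [u c2]; the rise of the other is the strict gain. *)
have := @F_adj (d u) 2 2 isT du isT; have := @degree_gain_gt0 2 isT.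
have := @F_sym (d u).+1 1 isT isT; rewrite mulr2n /=.
by move: P0; move: (wsum _ _) => W; lra.
Qed.

Lemma degenerate_step : step_goal.
Proof.
have [euv|neuv] := boolP (e u v); first by case: (no_degenerate_triangle euv).
have Nv y : e v y -> e u y.
  by move=> evy; case/orP: (nbr_v evy) => // /eqP E; rewrite E se (negPf neuv) in evy.
have [gt2|le2] := ltnP 2 #|nbr e v|.
  case/card_gt2P: gt2 => x [y [z [[]]]]; rewrite !inE => evx evy evz [xy yz zx].
  rewrite eq_sym in zx.
  case: (no_theta se ie ce sumde uv xy zx yz (Nv _ evx) evx (Nv _ evy) evy
    (Nv _ evz) evz).
have dv2 : d v = 2 by apply/eqP; rewrite eqn_leq dv -de le2.
have /card_gt1P[c1 [c2 []]] : (1 < #|nbr e v|)%N.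
  by have := de v; rewrite /degr => ->.
rewrite !inE => evc1 evc2 c12; have [euc1 euc2] := (Nv _ evc1, Nv _ evc2).
have [ec1u ec1v] : e c1 u /\ e c1 v by rewrite !(se c1).
have [ec2u ec2v] : e c2 u /\ e c2 v by rewrite !(se c2).
have nec : ~~ e c1 c2.
  by apply/negP => ec; apply: (no_diamond se ie ce sumde ec uv).
have dc1 : (1 < d c1)%N by exact: two_nbrs ec1u ec1v uv.
have dc2 : (1 < d c2)%N by exact: two_nbrs ec2u ec2v uv.
have c21 : c2 != c1 by rewrite eq_sym.
(* Otherwise [z] would be a third common neighbour of [c1] and [c2] besides [u] and [v]. *)
have near l z : d l = 1%N -> e z l -> z = u.
  move=> dl ezl; apply/eqP/negPn/negP => zu.
  have n1 := leaf_nbr_near dv2 evc1 evc2 c12 dc1 dc2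
    (or_intror (ex_intro2 _ _ u uv (conj ec1u euc2))) dl ezl.
  have n2 := leaf_nbr_near dv2 evc2 evc1 c21 dc2 dc1
    (or_intror (ex_intro2 _ _ u uv (conj ec2u euc1))) dl ezl.
  have zc1 : z != c1.
    by apply/eqP => E; move: n2; rewrite E (negPf c12) (negPf nec).
  have zc2 : z != c2.
    by apply/eqP => E; move: n1; rewrite E (negPf c21) se (negPf nec).
  rewrite (negPf zc1) /= in n1; rewrite (negPf zc2) /= in n2.
  have vz : v != z.
    apply/eqP => E; rewrite -E in ezl.
    have [l1|l1] := eqVneq l c1; first by rewrite -l1 dl in dc1.
    have [l2|l2] := eqVneq l c2; first by rewrite -l2 dl in dc2.
    have : (2 < #|nbr e v|)%N.
      by apply/card_gt2P; exists c1, c2, l; split; split; rewrite ?inE // eq_sym.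
    by rewrite ltnNge le2.
  have uz : u != z by rewrite eq_sym.
  by apply: (no_theta se ie ce sumde c12 uv uz vz) => //; rewrite se.
pose L := [set x | d x == 1%N].
(* All leaves hang at [u] next to [c1] and [c2]; the lower bound on leaves then forces
   [d c1 = d c2 = 2]. *)
have cL : (#|L| + 2 <= d u)%N.
  have c_seq : uniq [:: c1; c2] by rewrite /= inE c12.
  have -> : L = nbr e u :&: L.
    apply/setP => l; rewrite !inE; case: eqP => [dl|]; last by rewrite andbF.
    by have [z ezl] := exists_nbr l; rewrite -(near _ _ dl ezl) ezl.
  apply: (@leaf_nbrs_card u [:: c1; c2]) => // w; rewrite !inE;
  by case/orP => /eqP->.
have uc1 : u != c1 by apply/eqP => E; rewrite E ie in euc1.
have uc2 : u != c2 by apply/eqP => E; rewrite E ie in euc2.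
have lb1 := leaf_lower_bound dpos sumd uc1.
have lb2 := leaf_lower_bound dpos sumd uc2.
by apply: (@square_step c1 c2) => //; move: cL lb1 lb2 dc1 dc2; rewrite -/L; clear; lia.
Qed.

End Degenerate.

Lemma unicyclic_step : (\sum_x d x = 2 * #|T|)%N ->
  (forall z, z != v -> (d v <= d z)%N -> (r v < r z)%N) ->
  (d v = 2 -> (3 < #|[set x | 1 < d x]|)%N) -> step_goal.
Proof.
move=> sumd v_min four.
have [/existsP[w /and3P[evw wu neuw]]|] :=
    boolP [exists w, [&& e v w, w != u & ~~ e u w]]; last first.
  rewrite negb_exists => /forallP nw; apply: degenerate_step => // w evw.
  by have := nw w; rewrite evw /= negb_and !negbK.
have [euv|neuv] := boolP (e u v); first by apply: linked_step evw neuw wu; left.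
have [/existsP[c /andP[euc evc]]|] := boolP [exists c, e u c && e v c].
  by apply: linked_step evw neuw wu; right; exists c.
rewrite negb_exists => /forallP nc; apply: unlinked_step => // c euc.
by have := nc c; rewrite euc.
Qed.

End Hubs.
End Step.

(** * From one transfer to a chain of transfers *)

Lemma exists_transfer (d : T -> nat) (e : rel T) u v :
  feasible d e -> (forall x, 0 < d x)%N -> (\sum_x d x = 2 * #|T|)%N ->
  u != v -> (d v <= d u)%N -> (1 < d v)%N ->
  (d v = 2 -> (3 < #|[set x | 1 < d x]|)%N) ->
  exists e' : rel T, feasible (unit_transfer d u v) e' /\
    wsum (weight d) e < wsum (weight (unit_transfer d u v)) e'.
Proof.
move=> fe dpos sumd uv duv dv four.
(* The offset stays below [#|T|.+1], so degrees decide first; the value 0, reserved for [v], ranks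
   [v] lowest among the vertices of its degree. *)
pose c x := if x == v then 0%N else (enum_rank x).+1.
pose r x := (d x * #|T|.+1 + c x)%N.
have c_lt x : (c x < #|T|.+1)%N.
  by rewrite /c; case: ifP => // _; rewrite ltnS ltn_ord.
have r_deg x y : (d x < d y)%N -> (r x < r y)%N.
  move=> dxy; rewrite /r; apply: (@leq_trans ((d x).+1 * #|T|.+1)%N).
    by rewrite mulSn addnC ltn_add2r.
  by apply: leq_trans (leq_addr _ _); rewrite leq_mul2r dxy orbT.
have c_inj : injective c.
  move=> x y; rewrite /c; case: (eqVneq x v) => [->|_].
    by case: (eqVneq y v) => [->|].
  by case: (eqVneq y v) => [->|_] // [] /val_inj/enum_rank_inj.
have r_inj : injective r.
  move=> x y rxy; apply: c_inj; have : d x = d y.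
    by case: (ltngtP (d x) (d y)) => // /r_deg; rewrite rxy ltnn.
  by move=> dxy; move/eqP: rxy; rewrite /r dxy eqn_add2l => /eqP.
have v_min z : z != v -> (d v <= d z)%N -> (r v < r z)%N.
  move=> zv; rewrite leq_eqVlt => /orP[/eqP dvz|/r_deg //].
  by rewrite /r dvz ltn_add2l /c eqxx (negPf zv).
have [e0 opt] := exists_lex_optimal (weight d) (rank_weight r) fe.
have rvu : (r v < r u)%N by exact: v_min.
have [e' [fe' lt']] := unicyclic_step dpos r_inj r_deg opt uv duv dv rvu sumd v_min four.
by exists e'; split=> //; apply: le_lt_trans lt'; case: (opt.2 _ fe).
Qed.

(** The unit lost at [v] counts at thresholds below [d v], the unit gained at [u] at thresholds up
    to [d u]. *)
Lemma excess_unit_transfer (d : T -> nat) u v k : u != v -> (d v <= d u)%N ->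
  (0 < d v)%N ->
  excess (degree_list (unit_transfer d u v)) k =
  (excess (degree_list d) k + (d v <= k <= d u))%N.
Proof.
move=> uv duv dv; have vu : v != u by rewrite eq_sym.
rewrite !excess_degree_list (bigD1 u) //= (bigD1 v) //=.
rewrite [in RHS](bigD1 u) //= [in RHS](bigD1 v) //=.
rewrite {1 2}/unit_transfer eqxx (negPf vu) eqxx.
rewrite (eq_bigr (fun x => d x - k)%N); last first.
  by move=> x /andP[xu xv]; rewrite /unit_transfer (negPf xu) (negPf xv).
move: (\sum_(i | _) _)%N => A; move: duv dv; move: (d u) (d v) => a b; clear; lia.
Qed.

(* [k1, k3) is the first run of thresholds where the excess of [d] is below
   that of [t]. Along it the excess of [d] turns more than that of [t], so at
   least two degrees lie in the run, and moving a unit from the smaller to the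
   larger raises the excess only inside the run. *)
Lemma exists_transfer_pair (t : seq nat) (d : T -> nat) :
  (forall x, 0 < d x)%N -> (\sum_x d x = 2 * #|T|)%N ->
  size t = #|T| -> all (leq 1) t -> sumn t = (2 * #|T|)%N ->
  (3 <= count (leq 2) t)%N ->
  (forall k, excess (degree_list d) k <= excess t k)%N ->
  ~~ perm_eq (degree_list d) t ->
  exists u v, [/\ u != v, (d v <= d u)%N, (1 < d v)%N,
    d v = 2 -> (3 < #|[set x | 1 < d x]|)%N &
    forall k, (d v <= k <= d u)%N -> (excess (degree_list d) k < excess t k)%N].
Proof.
move=> dpos sumd st post sumt nlt le_dt neq.
pose D := degree_list d; pose lt_at k := (excess D k < excess t k)%N.
have sD : size D = #|T| by exact: size_degree_list.
have sumD : sumn D = (2 * #|T|)%N by rewrite sumn_degree_list.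
have posD : all (leq 1) D by apply/allP => a /mapP[x _ ->]; apply: dpos.
have ex1 : exists k, lt_at k.
  case: (pselect (exists k, lt_at k)) => // nex; case/negP: neq.
  apply: perm_eq_excess; first by rewrite sD st.
  move=> k; apply/eqP; rewrite eqn_leq le_dt /= leqNgt; apply/negP => ltk.
  by apply: nex; exists k.
case: (ex_minnP ex1) => k1 lt1 min1.
have eq_below k : (k < k1)%N -> excess D k = excess t k.
  move=> kk1; apply/eqP; rewrite eqn_leq le_dt /= leqNgt; apply/negP => /min1.
  by rewrite leqNgt kk1.
(* At thresholds 0 and 1 the excess of positive entries depends only on their sum and number, which
   agree. *)
have k1_gt1 : (1 < k1)%N.
  case: k1 lt1 {min1 eq_below} => [|[|//]]; rewrite /lt_at.
    by rewrite !excess0 sumD sumt ltnn.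
  by have := excess_pos posD; have := excess_pos post; rewrite sD st sumD sumt; lia.
have ex3 : exists k, (k1 <= k)%N && (excess D k == excess t k).
  exists (k1 + 2 * #|T|)%N; rewrite leq_addr !excess_large ?eqxx //;
  by rewrite ?sumt ?sumD leq_addl.
case: (ex_minnP ex3) => k3 /andP[k13 /eqP eq3] min3.
have lt_run k : (k1 <= k < k3)%N -> lt_at k.
  case/andP => k1k kk3; rewrite /lt_at ltn_neqAle le_dt andbT; apply/negP => eqk.
  by have := min3 k; rewrite k1k eqk => /(_ isT); rewrite leqNgt kk3.
have k1k3 : (k1 < k3)%N.
  rewrite ltn_neqAle k13 andbT; apply/eqP => E.
  by move: lt1; rewrite /lt_at E eq3 ltnn.
(* From [k] to [k.+1] the excess drops by the number of entries that are at least [k.+1]; this turns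
   both ends of the run into comparisons of counts. *)
have cnt1 : (count (leq k1) t < count (leq k1) D)%N.
  have E := eq_below k1.-1; move: E lt1.
  by rewrite (excessS D) (excessS t) /lt_at prednK; move: k1_gt1; clear; lia.
have cnt3 : (count (leq k3) D < count (leq k3) t)%N.
  have : lt_at k3.-1 by apply: lt_run; move: k1k3; clear; lia.
  rewrite /lt_at (excessS D) (excessS t) prednK; first by rewrite eq3 ltn_add2l.
  by apply: leq_ltn_trans k1k3.
have cnt_t : (count (leq k3) t <= count (leq k1) t)%N.
  by apply: sub_count => a /=; apply: leq_trans.
pose A := [set x | (k1 <= d x < k3)%N].
have /card_gt1P[x [y [xA yA xy]]] : (1 < #|A|)%N.
  have : (count (leq k1) D = #|A| + count (leq k3) D)%N.
    rewrite !count_degree_list -(cardsID A) setIC; congr (_ + _)%N.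
      apply: eq_card => x; rewrite !inE.
      by case: (k1 <= d x)%N => //; rewrite andbT.
    apply: eq_card => x; rewrite !inE; move: k13; clear; lia.
  by move: cnt1 cnt3 cnt_t; clear; lia.
have key u v : u \in A -> v \in A -> u != v -> (d v <= d u)%N ->
  exists u v, [/\ u != v, (d v <= d u)%N, (1 < d v)%N,
    d v = 2 -> (3 < #|[set x | 1 < d x]|)%N &
    forall k, (d v <= k <= d u)%N -> (excess D k < excess t k)%N].
  rewrite !inE => /andP[_ uk3] /andP[vk1 _] uv duv; exists u, v; split => //.
  - exact: leq_trans vk1.
  (* The run then starts at 2, so [d] has more non-leaves than [t], which has at least three. *)
  - move=> dv2; have k12 : k1 = 2 by move: k1_gt1 vk1; rewrite dv2; clear; lia.
    move: cnt1; rewrite k12 /D (count_degree_list (leq 2) d).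
    by apply: leq_ltn_trans.
  - move=> k /andP[vk ku]; apply: lt_run.
    by rewrite (leq_trans vk1 vk) (leq_ltn_trans ku uk3).
case/orP: (leq_total (d x) (d y)) => dxy; last exact: key xA yA xy dxy.
by apply: key yA xA _ dxy; rewrite eq_sym.
Qed.

(** Each transfer raises the total excess [mu] while staying below [t], so the chain ends at [t] up
    to order. *)
Lemma majorization_chain (t : seq nat) (d : T -> nat) (e : rel T) :
  feasible d e -> (forall x, 0 < d x)%N -> (\sum_x d x = 2 * #|T|)%N ->
  size t = #|T| -> all (leq 1) t -> sumn t = (2 * #|T|)%N ->
  (3 <= count (leq 2) t)%N ->
  (forall k, excess (degree_list d) k <= excess t k)%N ->
  ~~ perm_eq (degree_list d) t ->
  exists (d' : T -> nat) (e' : rel T),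
    [/\ feasible d' e', perm_eq (degree_list d') t, (forall x, 0 < d' x)%N
      & wsum (weight d) e < wsum (weight d') e'].
Proof.
move=> + + + st post sumt nlt.
(* The degrees sum to [2 * #|T|], so this window contains the threshold [d v], where a transfer
   raises the excess. *)
pose N := (2 * #|T|).+1.
pose mu (s : seq nat) := (\sum_(k < N) excess s k)%N.
have [n] := ubnP (mu t - mu (degree_list d)); elim: n d e => // n IH d e ltn.
move=> fe dpos sumd le_dt neq.
have [u [v [uv duv dv four lt_uv]]] :=
  exists_transfer_pair dpos sumd st post sumt nlt le_dt neq.
have [e1 [fe1 lt1]] := exists_transfer fe dpos sumd uv duv dv four.
set d1 := unit_transfer d u v in fe1 lt1.
have ex1 k : excess (degree_list d1) k =
    (excess (degree_list d) k + (d v <= k <= d u))%N.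
  by apply: excess_unit_transfer => //; apply: ltnW.
have d1pos x : (0 < d1 x)%N by apply: unit_transfer_gt0.
have sumd1 : (\sum_x d1 x = 2 * #|T|)%N.
  rewrite -sumn_degree_list -excess0 ex1 excess0 sumn_degree_list sumd leqn0.
  by rewrite gtn_eqF ?addn0 // ltnW.
have le_d1 k : (excess (degree_list d1) k <= excess t k)%N.
  rewrite ex1; case E: (_ && _); rewrite ?addn0 // addn1.
  exact: lt_uv.
have [eq1|neq1] := boolP (perm_eq (degree_list d1) t).
  by exists d1, e1.
have mu1 : (mu (degree_list d) < mu (degree_list d1))%N.
  have dvN : (d v < N)%N by rewrite ltnS -sumd (bigD1 v) //= leq_addr.
  rewrite /mu (bigD1 (Ordinal dvN)) //= [ltnRHS](bigD1 (Ordinal dvN)) //=.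
  rewrite ex1 leqnn duv addn1 addSn ltnS leq_add2l.
  by apply: leq_sum => k _; rewrite ex1 leq_addr.
have mut : (mu (degree_list d1) <= mu t)%N by apply: leq_sum => k _.
have [|d2 [e2 [fe2 eq2 pos2 lt2]]] := IH d1 e1 _ fe1 d1pos sumd1 le_d1 neq1.
  by move: ltn mu1 mut; clear; lia.
by exists d2, e2; split=> //; apply: lt_trans lt1 lt2.
Qed.

End Weight.

(** * Good escalating functions *)

Section GoodEscalating.
Variables (R : realType) (f : R -> R -> R).
Hypotheses (hsym : symmetric_pos f) (hf : good_escalating f).

Lemma escalating_increment (a b p q : R) : 0 < b -> b <= a -> 0 < q -> q <= p ->
  f a q + f b p <= f a p + f b q.
Proof.
move=> b0 ba q0 qp; case: hf => esc _ _ _.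
have [+ _] := esc a p b q b0 ba q0 qp.
by rewrite (hsym (lt_le_trans q0 qp) b0) addrC.
Qed.

Lemma increment_mean_value (g : R -> R) (a b : R) : 0 < a -> a < b ->
  (forall x, 0 < x -> derivable g x 1) ->
  exists2 c, a < c < b & g b - g a = g^`()%classic c * (b - a).
Proof.
move=> a0 ab dg; have [||c] := @MVT R g g^`()%classic a b ab.
- move=> x; rewrite in_itv /= => /andP[ax _].
  by rewrite derive1E; apply: DeriveDef => //; apply: dg; apply: lt_trans ax.
- apply: derivable_within_continuous => x; rewrite in_itv /= => /andP[ax _].
  by apply: dg; apply: lt_le_trans ax.
by rewrite in_itv /= => cab ->; exists c.
Qed.

Lemma good_escalating_lt (a b p : R) : 0 < a -> a < b -> 0 < p -> f a p < f b p.
Proof.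
move=> a0 ab p0; case: hf => _ d1 _ _.
have [x x0|c /andP[ac cb] E] := @increment_mean_value (fun t => f t p) a b a0 ab.
  by case: (d1 x p x0 p0).
have [_ pos] := d1 c p (lt_trans a0 ac) p0.
by rewrite -subr_gt0 E mulr_gt0 // subr_gt0.
Qed.

(** Escalation lowers [p] to [q]; both unit increments are then values of the derivative, at points
    of the intervals from [b - 1] to [b] and from [a] to [a + 1], ordered by convexity. *)
Lemma good_escalating_inc (a b p q : R) : 1 < b -> b <= a -> 0 < q -> q <= p ->
  f b q - f (b - 1) q <= f (a + 1) p - f a p.
Proof.
move=> b1 ba q0 qp; have [_ d1 d2 _] := hf.
have a0 : 0 < a by apply: lt_le_trans ba; apply: lt_trans b1.
have b10 : 0 < b - 1 by rewrite subr_gt0.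
apply: (@le_trans _ _ (f (a + 1) q - f a q)); last first.
  have := @escalating_increment (a + 1) a p q a0 _ q0 qp.
  by rewrite lerDl => /(_ ler01); lra.
have dq x : 0 < x -> derivable (fun t => f t q) x 1.
  by move=> x0; case: (d1 x q x0 q0).
have bb : b - 1 < b by rewrite ltrBlDr ltrDl.
have aa : a < a + 1 by rewrite ltrDl.
have [c /andP[bc cb] ->] := increment_mean_value b10 bb dq.
have [c' /andP[ac' c'a] ->] := increment_mean_value a0 aa dq.
have c0 : 0 < c by exact: lt_trans bc.
have cc' : c < c' by apply: lt_trans ac'; apply: lt_le_trans ba.
rewrite opprB addrC subrK mulr1 (addrC a) addrK mulr1 -subr_ge0.
(* The mean value theorem for the derivative itself gives its monotonicity. *)
have [x x0|c2 /andP[cc2 _] ->] :=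
    @increment_mean_value (fun t => f t q)^`()%classic c c' c0 cc'.
  by case: (d2 x q x0 q0).
have [_ pos] := d2 c2 q (lt_trans c0 cc2) q0.
by rewrite mulr_ge0 // subr_ge0 ltW.
Qed.

Definition nat_weight (a b : nat) : R := f a%:R b%:R.

Lemma nat_weight_sym a b : (0 < a)%N -> (0 < b)%N ->
  nat_weight a b = nat_weight b a.
Proof. by move=> a0 b0; apply: hsym; rewrite ltr0n. Qed.

Lemma nat_weight_esc a b p q : (0 < b)%N -> (b <= a)%N -> (0 < q)%N ->
  (q <= p)%N -> nat_weight a q + nat_weight b p <= nat_weight a p + nat_weight b q.
Proof. by move=> *; apply: escalating_increment; rewrite ?ltr0n ?ler_nat. Qed.

Lemma nat_weight_lt a b p : (0 < a)%N -> (a < b)%N -> (0 < p)%N ->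
  nat_weight a p < nat_weight b p.
Proof. by move=> *; apply: good_escalating_lt; rewrite ?ltr0n ?ltr_nat. Qed.

Lemma nat_weight_inc a b p q : (1 < b)%N -> (b <= a)%N -> (0 < q)%N ->
  (q <= p)%N ->
  nat_weight b q - nat_weight b.-1 q <= nat_weight a.+1 p - nat_weight a p.
Proof.
move=> b1 ba q0 qp; rewrite /nat_weight -subn1 natrB ?(ltnW b1) // -[a.+1%:R]natr1.
by apply: good_escalating_inc; rewrite ?ltr0n ?ler_nat ?ltr1n.
Qed.

Lemma nat_weight_adj a b q : (1 < b)%N -> (b <= a)%N -> (0 < q)%N ->
  nat_weight q b + nat_weight a b <= nat_weight a.+1 q + nat_weight a.+1 b.-1.
Proof.
move=> b1 ba q0; have [_ _ _ adj] := hf.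
rewrite /nat_weight -subn1 natrB ?(ltnW b1) // -[a.+1%:R]natr1.
by apply: adj; rewrite ?ler_nat ?ltr1n ?ler1n.
Qed.

End GoodEscalating.

(** * Passing between graphs and relations, and the conclusion *)

Section Handshake.
Variable G : sgraph.

(** Swapping a pair carries the decreasing orientations of edges to the increasing ones, which
    [edges] collects. *)
Lemma wsum_edges (V : nmodType) (g : vertex G -> vertex G -> V) :
  (forall x y, g x y = g y x) ->
  wsum g (@adj G) = (\sum_(p in edges G) g p.1 p.2) *+ 2.
Proof.
move=> gs; rewrite wsum_pair (bigID (fun p => enum_rank p.1 < enum_rank p.2)%N) /=.
rewrite mulr2n; congr (_ + _); first by apply: eq_bigl => p; rewrite inE.
rewrite (reindex_inj (h := fun p : vertex G * vertex G => (p.2, p.1))) /=; last first.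
  by move=> [a b] [c d] [-> ->].
apply: eq_big => [[a b]|[a b] _] /=; last exact: gs.
rewrite inE /= adj_sym -leqNgt leq_eqVlt.
case: (boolP (adj a b)) => //= eab.
have [/eqP/val_inj/enum_rank_inj E|] //= := boolP (_ == _ :> nat).
by rewrite E adj_irr in eab.
Qed.

Lemma sum_degr_edges : (\sum_x degr (@adj G) x = 2 * #|edges G|)%N.
Proof.
by rewrite sum_degr (@wsum_edges nat) // sum1_card mulr2n mul2n -addnn.
Qed.

Lemma degree_seq_perm : perm_eq (degree_list (degr (@adj G))) (degree_seq G).
Proof.
by rewrite /degree_seq perm_sym perm_sort.
Qed.

Lemma degree_seq_sorted : sorted geq (degree_seq G).
Proof. by apply: sort_sorted => x y; apply: leq_total. Qed.

End Handshake.

Lemma unicyclic_degree_seqP (s : seq nat) : unicyclic_degree_seq s ->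
  [/\ sorted geq s, all (leq 1) s, sumn s = (2 * size s)%N,
      (3 <= count (leq 2) s)%N & (0 < size s)%N].
Proof.
case=> G [[[n0 ce] nE] <-]; set e := @adj G.
have sumd : (\sum_x degr e x = 2 * #|vertex G|)%N by rewrite sum_degr_edges nE.
have perm := degree_seq_perm G; have szE := perm_size perm.
rewrite size_degree_list in szE.
have nl := unicyclic_three_nonleaves (@adj_irr G) (@adj_sym G) sumd n0.
rewrite -szE; split=> //.
- exact: degree_seq_sorted.
- rewrite -(perm_all _ perm); apply/allP => a /mapP[x _ ->].
  (* Three non-leaves exist, so [x] is not the only vertex, and connectedness gives it a
     neighbour. *)
  have [z] : exists z, z \notin [set x].
    apply/existsP; rewrite -negb_forall; apply/negP => /forallP all1.
    have : (#|[set y | (1 < degr e y)%N]| <= #|[set x]|)%N.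
      by apply: subset_leq_card; apply/subsetP => y _; apply: all1.
    by rewrite cards1 => /(leq_trans nl).
  move=> zx; have [y [w [/set1P-> _ eyw]]] := crossing_edge ce (set11 x) zx.
  by apply/card_gt0P; exists w; rewrite inE.
- by rewrite -(perm_sumn perm) sumn_degree_list.
- by rewrite -(permP perm) count_degree_list.
Qed.

Lemma sorted_geq_perm_eq (s t : seq nat) :
  sorted geq s -> sorted geq t -> perm_eq s t -> s = t.
Proof.
apply: sorted_eq; first by move=> a b c /= ba ac; apply: leq_trans ac ba.
by move=> a b /=; rewrite andbC => /anti_leq.
Qed.

Section FeasibleGraph.
Variables (T : finType) (d : T -> nat) (e : rel T).
Hypothesis fe : feasible d e.

Let se : symmetric e. Proof. by case: fe. Qed.
Let ie : irreflexive e. Proof. by case: fe. Qed.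

Definition graph_of_feasible : sgraph := SGraph se ie.

Lemma Gamma_graph_of_feasible (s : seq nat) : sorted geq s -> (0 < #|T|)%N ->
  perm_eq (degree_list d) s -> Gamma s graph_of_feasible.
Proof.
case: fe => _ _ ce de ss T0 perm; split; first by split.
apply: sorted_geq_perm_eq => //; first exact: degree_seq_sorted.
apply: perm_trans perm; rewrite perm_sym.
have <- : degree_list (degr e) = degree_list d by apply: eq_map.
exact: (degree_seq_perm graph_of_feasible).
Qed.

End FeasibleGraph.

(** Positive degrees put all arguments where [f] is symmetric; the factor 2 counts both
    orientations. *)
Lemma wsum_Mf (R : realType) (f : R -> R -> R) (G : sgraph) :
  symmetric_pos f -> (forall x : vertex G, 0 < deg x)%N ->
  wsum (weight (nat_weight f) (@deg G)) (@adj G) = Mf f G *+ 2.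
Proof.
move=> hsym dpos; rewrite wsum_edges // => x y.
by rewrite /weight /nat_weight hsym // ltr0n.
Qed.

Theorem theorem6 (R : realType) (f : R -> R -> R) (pi pi' : seq nat)
    (U U' : sgraph)
    (hpi : unicyclic_degree_seq pi) (hpi' : unicyclic_degree_seq pi')
    (hmaj : majorized pi pi')
    (hsym : symmetric_pos f) (hf : good_escalating f)
    (hU : extremal f pi U) (hU' : extremal f pi' U') :
  Mf f U < Mf f U'.
Proof.
have [ss ps sums _ n0] := unicyclic_degree_seqP hpi.
have [ss' ps' sums' nl' _] := unicyclic_degree_seqP hpi'.
have [sz neq _ le_take] := hmaj.
have [[[_ ce] dsU] _] := hU.
pose e := @adj U; pose d := @deg U.
have perm : perm_eq (degree_list d) pi by rewrite -dsU; exact: degree_seq_perm.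
have szT : size pi = #|vertex U| by rewrite -(perm_size perm) size_degree_list.
have fe : feasible d e by split=> //; [exact: adj_sym | exact: adj_irr].
have dpos x : (0 < d x)%N.
  move: ps; rewrite -(perm_all _ perm) => /allP; apply.
  by apply: map_f; rewrite mem_enum.
have sumd : (\sum_x d x = 2 * #|vertex U|)%N.
  by rewrite -sumn_degree_list (perm_sumn perm) sums szT.
have le_exc k : (excess (degree_list d) k <= excess pi' k)%N.
  rewrite /excess (perm_big _ perm); exact: excess_le.
have nperm : ~~ perm_eq (degree_list d) pi'.
  apply/negP => perm'; apply: neq; apply: sorted_geq_perm_eq => //.
  by apply: perm_trans perm'; rewrite perm_sym.
have szT' : size pi' = #|vertex U| by rewrite -sz.
rewrite -sz szT in sums'.
(* The chain stays on the vertex set of [U] and ends in a competitor of [U']. *)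
have [d' [e' [fe' perm' dpos' lt_w]]] := majorization_chain
  (nat_weight_sym hsym) (nat_weight_esc hsym hf) (nat_weight_lt hf)
  (nat_weight_inc hsym hf) (nat_weight_adj hf)
  fe dpos sumd szT' ps' sums' nl' le_exc nperm.
pose H := graph_of_feasible fe'.
have GH : Gamma pi' H by apply: Gamma_graph_of_feasible => //; rewrite -szT.
have degH : @deg H = d' by apply/funext => x; case: (fe') => _ _ _; apply.
apply: lt_le_trans (hU'.2 _ GH).
have dposH (x : vertex H) : (0 < deg x)%N by rewrite degH.
have := wsum_Mf hsym dposH; rewrite degH => WH.
by move: lt_w; rewrite (wsum_Mf hsym dpos) [X in _ < X]WH ltr_pMn2r.
Qed.
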